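(* Let $A$ be a higher Auslander algebra of global dimension $d$. The following assertions are equivalent: (1) $A$ is of finite representation type. (2) The subcategory of $A$-modules of projective dimension $d$ is of finite type. (3) The subcategory of $A$-modules of injective dimension $d$ is of finite type. (4) The subcategory of $A$-modules of dominant dimension zero is of finite type. (5) The subcategory of $A$-modules of codominant dimension zero is of finite type.
   Context: Algebras are finite-dimensional connected algebras over a field $K$; modules are finitely generated right modules. A subcategory of the category of finitely generated $A$-modules is of finite type if it contains only finitely many indecomposable modules up to isomorphism; $A$ is of finite representation type if there are only finitely many indecomposable $A$-modules up to isomorphism. For a minimal injective coresolution $0\to M\to I^0\to I^1\to\cdots$, the dominant dimension of $M$ is the smallest $n$ such that $I^n$ is not projective, and $\infty$ if there is none. Dually, the codominant dimension of $M$ is the smallest $n$ such that the term $P_n$ of a minimal projective resolution of $M$ is not injective, and $\infty$ if there is none. $\operatorname{domdim}A$ is the dominant dimension of the regular module. $A$ is a higher Auslander algebra if $\operatorname{gldim}A=\operatorname{domdim}A\ge2$ (finite), or $A$ is semisimple. *)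

(* Defs.v *)
From HB Require Import structures.
From mathcomp Require Import all_boot all_order all_algebra all_field.
From mathcomp Require Import boolp classical_sets.

Set Implicit Arguments.
Unset Strict Implicit.
Unset Printing Implicit Defensive.

Import GRing.Theory.

Local Open Scope classical_set_scope.
Local Open Scope ring_scope.

(* MathComp's [lmodType R] are left modules. Everything below is stated for left
   modules over a ring R; right modules over A are obtained by taking R := A^c,
   the converse (opposite) ring, for which [a *: m] is the right action m a and
   the right regular module A_A is [(A^c)^o]. *)

Section Modules.
Variable R : nzRingType.
Implicit Types M N P I X Y : lmodType R.

Definition fg M : Prop :=
  exists (n : nat) (g : 'I_n -> M),
    forall x : M, exists c : 'I_n -> R, x = \sum_(i < n) c i *: g i.

Definition isomorphic M N : Prop := exists f : {linear M -> N}, bijective f.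

Definition trivial_mod M : Prop := forall x : M, x = 0.

Definition indecomposable M : Prop :=
  ~ trivial_mod M /\
  forall X Y, isomorphic M (X * Y)%type -> trivial_mod X \/ trivial_mod Y.

Definition submodule M (S : set M) : Prop := GRing.submod_closed (mem S).

Definition ker M N (f : {linear M -> N}) : set M := f @^-1` [set 0].

Definition simple_submodule M (S : set M) : Prop :=
  [/\ submodule S, S <> [set 0] &
      forall T : set M, submodule T -> T `<=` S -> T = [set 0] \/ T = S].

Definition semisimple M : Prop :=
  exists (n : nat) (S : 'I_n -> set M),
    (forall i, simple_submodule (S i)) /\
    (forall x : M, exists! f : {ffun 'I_n -> M},
       (forall i, S i (f i)) /\ x = \sum_(i < n) f i).

Definition essential M (S : set M) : Prop :=
  forall T : set M, submodule T -> T `&` S = [set 0] -> T = [set 0].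

Definition superfluous M (S : set M) : Prop :=
  forall T : set M, submodule T ->
    (forall x, exists s t, [/\ S s, T t & x = s + t]) -> T = setT.

(* Projectivity and injectivity refer to the category of finitely generated
   modules. *)
Definition projective P : Prop :=
  forall M N, fg M -> fg N ->
  forall (g : {linear M -> N}) (f : {linear P -> N}), range g = setT ->
  exists h : {linear P -> M}, forall x, g (h x) = f x.

Definition injective_mod I : Prop :=
  forall M N, fg M -> fg N ->
  forall (g : {linear M -> N}) (f : {linear M -> I}), injective g ->
  exists h : {linear N -> I}, forall x, h (g x) = f x.

(* ... -> P_1 -> P_0 -> M -> 0; [pr_d n] is the map P_{n+1} -> P_n. *)
Record proj_resolution M := ProjResolution {
  pr_obj :> nat -> lmodType R;
  pr_aug : {linear pr_obj 0%N -> M};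
  pr_d : forall n, {linear pr_obj n.+1 -> pr_obj n};
  pr_fg : forall n, fg (pr_obj n);
  pr_proj : forall n, projective (pr_obj n);
  pr_aug_surj : range pr_aug = setT;
  pr_exact0 : range (pr_d 0%N) = ker pr_aug;
  pr_exact : forall n, range (pr_d n.+1) = ker (pr_d n)
}.

Definition minimal_proj M (P : proj_resolution M) : Prop :=
  superfluous (ker (pr_aug P)) /\ forall n, superfluous (ker (pr_d P n)).

(* 0 -> M -> I^0 -> I^1 -> ...; [ir_d n] is the map I^n -> I^{n+1}. *)
Record inj_coresolution M := InjCoresolution {
  ir_obj :> nat -> lmodType R;
  ir_aug : {linear M -> ir_obj 0%N};
  ir_d : forall n, {linear ir_obj n -> ir_obj n.+1};
  ir_fg : forall n, fg (ir_obj n);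
  ir_inj : forall n, injective_mod (ir_obj n);
  ir_aug_inj : injective ir_aug;
  ir_exact0 : range ir_aug = ker (ir_d 0%N);
  ir_exact : forall n, range (ir_d n) = ker (ir_d n.+1)
}.

Definition minimal_inj M (I : inj_coresolution M) : Prop :=
  essential (range (ir_aug I)) /\ forall n, essential (range (ir_d I n)).

(* The dimensions below are relations "the dimension is the natural number n";
   an infinite dimension is one that is related to no n. *)
Definition projdim_le M (n : nat) : Prop :=
  exists P : proj_resolution M, forall m, (n < m)%N -> trivial_mod (P m).

Definition projdim M (n : nat) : Prop :=
  projdim_le M n /\ forall m, projdim_le M m -> (n <= m)%N.

Definition injdim_le M (n : nat) : Prop :=
  exists I : inj_coresolution M, forall m, (n < m)%N -> trivial_mod (I m).

Definition injdim M (n : nat) : Prop :=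
  injdim_le M n /\ forall m, injdim_le M m -> (n <= m)%N.

Definition domdim M (n : nat) : Prop :=
  exists I : inj_coresolution M,
    [/\ minimal_inj I, ~ projective (I n) &
        forall m, (m < n)%N -> projective (I m)].

Definition codomdim M (n : nat) : Prop :=
  exists P : proj_resolution M,
    [/\ minimal_proj P, ~ injective_mod (P n) &
        forall m, (m < n)%N -> injective_mod (P m)].

(* The least upper bound of the projective dimensions of f.g. modules. *)
Definition gldim (n : nat) : Prop :=
  (forall M, fg M -> projdim_le M n) /\
  forall m, (forall M, fg M -> projdim_le M m) -> (n <= m)%N.

Definition finite_type (C : lmodType R -> Prop) : Prop :=
  exists (n : nat) (F : 'I_n -> lmodType R),
    forall M, fg M -> indecomposable M -> C M -> exists i, isomorphic M (F i).

End Modules.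

Definition connected_alg (K : fieldType) (A : falgType K) : Prop :=
  forall e : A, e * e = e -> (forall a : A, e * a = a * e) -> e = 0 \/ e = 1.

Definition higher_auslander (K : fieldType) (A : falgType K) : Prop :=
  (exists d : nat,
     [/\ (2 <= d)%N, gldim A^c d & domdim (A^c)^o d]) \/
  semisimple (A^c)^o.

(* Main.v *)
(* Let Q range over the projective-injective modules and let d >= 2 be the global
   and dominant dimension of A; the semisimple case is elementary.

   A module M has projective dimension < d iff it embeds in some Q. If it embeds,
   its cokernel has projective dimension at most d. Conversely let X be the
   largest submodule of M killed by all maps to some Q. Then X has projective
   dimension < d, and Ext^i(X, A) = 0 for i < d because A has a coresolution by
   modules Q up to degree d - 1; so the projective dimension of X drops to 0, X
   is projective and embeds in some Q, and X = 0. Dually, M has injective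
   dimension < d iff it is a quotient of some Q. This needs that an injective
   module has a resolution by modules Q up to degree d - 1, which is extracted
   from the coresolution of A without passing to the opposite algebra.

   A module of projective dimension d thus has dominant dimension 0, so (4)
   implies (2). For (2) => (1), an indecomposable nonprojective M with projective
   dimension k < d is the kernel of some Q -> C, and by Schanuel and
   Krull-Schmidt M is a direct summand of a syzygy of an indecomposable of
   projective dimension k + 1; descending from d, every indecomposable is a
   summand of one fixed module. The dual argument gives (5) => (3) => (1). *)

Require Import Defs.
From HB Require Import structures.
From mathcomp Require Import all_boot all_order all_algebra all_field.
From mathcomp Require Import boolp classical_sets.

Set Implicit Arguments.
Unset Strict Implicit.
Unset Printing Implicit Defensive.

Import GRing.Theory.

Local Open Scope ring_scope.

(** * Modules *)

Section LinearMaps.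
Variable R : nzRingType.
Implicit Types M N P X Y Z W : lmodType R.

Definition lin M N (f : M -> N) (hf : linear f) : {linear M -> N} :=
  HB.pack f (GRing.isLinear.Build R M N *:%R f hf).

(** A short exact sequence 0 -> X -> Y -> Z -> 0, in pointwise form so that elements can be chased
    directly. *)
Definition ses X Y Z (i : {linear X -> Y}) (p : {linear Y -> Z}) : Prop :=
  [/\ injective i, forall z, exists y, p y = z &
      forall y, p y = 0 <-> exists x, i x = y].

Lemma lin_inj M N (f : {linear M -> N}) :
  (forall x, f x = 0 -> x = 0) -> injective f.
Proof.
by move=> h x y e; apply/eqP; rewrite -subr_eq0; apply/eqP/h; rewrite linearB /= e subrr.
Qed.

Lemma inj0 M N (f : {linear M -> N}) x : injective f -> f x = 0 -> x = 0.
Proof. by move=> h e; apply: h; rewrite e linear0. Qed.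

Lemma ses_comp X Y Z (i : {linear X -> Y}) (p : {linear Y -> Z}) x :
  ses i p -> p (i x) = 0.
Proof. by case=> _ _ h; apply/h; exists x. Qed.

(** A chosen section of [q] need not be linear, but its composite with [h] is, because two preimages
    of a point differ by an element that [h] kills. *)
Lemma factor_surj W Y N (q : {linear W -> Y}) (h : {linear W -> N}) :
  (forall y, exists w, q w = y) -> (forall w, q w = 0 -> h w = 0) ->
  exists g : {linear Y -> N}, forall w, g (q w) = h w.
Proof.
move=> sq hk; pose s y := projT1 (cid (sq y)).
have qs y : q (s y) = y by rewrite /s; case: cid.
have eqh w w' : q w = q w' -> h w = h w'.
  by move=> e; apply/eqP; rewrite -subr_eq0 -linearB hk// linearB /= e subrr.
have hl : linear (fun y => h (s y)).
  by move=> a x y; rewrite -linearP; apply: eqh; rewrite linearP /= !qs.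
by exists (lin hl) => w /=; apply: eqh; rewrite qs.
Qed.

Lemma factor_inj X Y W (i : {linear X -> Y}) (h : {linear W -> Y}) :
  injective i -> (forall w, exists x, i x = h w) ->
  exists g : {linear W -> X}, forall w, i (g w) = h w.
Proof.
move=> ii hr; pose s w := projT1 (cid (hr w)).
have is_ w : i (s w) = h w by rewrite /s; case: cid.
have hl : linear s by move=> a x y; apply: ii; rewrite linearP /= !is_ linearP.
by exists (lin hl) => w; rewrite is_.
Qed.

Lemma lin_bij M N (f : {linear M -> N}) :
  injective f -> (forall y, exists x, f x = y) -> bijective f.
Proof.
move=> fi fs; have [|g gE] := @factor_surj _ _ _ f idfun fs.
  by move=> w; apply: inj0.
by exists g => // y; have [x <-] := fs y; rewrite gE.
Qed.

(** Direct summands up to isomorphism, without naming a complement; the Krull-Schmidt arguments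
    below are phrased in this form. *)
Definition retract M N : Prop :=
  exists (s : {linear M -> N}) (r : {linear N -> M}), forall x, r (s x) = x.

Lemma retract_refl M : retract M M.
Proof. by exists idfun, idfun. Qed.

Lemma retract_trans M N P : retract M N -> retract N P -> retract M P.
Proof.
move=> [s [r h]] [s' [r' h']]; exists (s' \o s), (r \o r') => x /=.
by rewrite h' h.
Qed.

Lemma iso_retract M N : isomorphic M N -> retract M N.
Proof.
move=> [f fb]; have [f' f'K fK] := fb.
have [||g gE] := @factor_surj _ _ _ f idfun.
- by move=> y; exists (f' y).
- by move=> w; apply: inj0; apply: bij_inj.
- by exists f, g.
Qed.

Lemma iso_sym M N : isomorphic M N -> isomorphic N M.
Proof.
move=> [f [f' f'K fK]].
have hl : linear f' by move=> a x y; apply: (can_inj f'K); rewrite linearP /= !fK.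
by exists (lin hl); exists f.
Qed.

Lemma iso_trans M N P : isomorphic M N -> isomorphic N P -> isomorphic M P.
Proof. by move=> [f hf] [g hg]; exists (g \o f); apply: bij_comp. Qed.

Definition linl M N : {linear M -> (M * N)%type}.
Proof.
apply: (@lin _ _ (fun x => (x, 0))) => a x y.
by apply/pair_equal_spec; split; rewrite //= scaler0 addr0.
Defined.

Definition linr M N : {linear N -> (M * N)%type}.
Proof.
apply: (@lin _ _ (fun x => (0, x))) => a x y.
by apply/pair_equal_spec; split; rewrite //= scaler0 addr0.
Defined.

Definition scalemap M (m : M) : {linear R^o -> M}.
Proof.
by apply: (@lin _ _ (fun r : R^o => r *: m)) => a x y; rewrite scalerDl scalerA.
Defined.

Lemma retract_prodl M N : retract M (M * N)%type.
Proof. by exists (linl M N), fst. Qed.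

Lemma retract_prodr M N : retract N (M * N)%type.
Proof. by exists (linr M N), snd. Qed.

Definition pairmap M N P (f : {linear P -> M}) (g : {linear P -> N}) :
    {linear P -> (M * N)%type}.
Proof.
apply: (@lin _ _ (fun x => (f x, g x))) => a x y.
by rewrite !linearP.
Defined.

Definition copairmap M N P (f : {linear M -> P}) (g : {linear N -> P}) :
    {linear (M * N)%type -> P} := (f \o fst) \+ (g \o snd).

Lemma retract_prod M N M' N' :
  retract M M' -> retract N N' -> retract (M * N)%type (M' * N')%type.
Proof.
move=> [s [r h]] [s' [r' h']].
exists (pairmap (s \o fst) (s' \o snd)), (pairmap (r \o fst) (r' \o snd)).
by case=> x y /=; rewrite h h'.
Qed.

Definition fmap n M P (f : 'I_n -> {linear P -> M}) :
  {linear P -> {ffun 'I_n -> M}}.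
Proof.
apply: (@lin _ _ (fun x => [ffun i => f i x])) => a x y.
by apply/ffunP => i; rewrite !ffunE linearP.
Defined.

Definition fsummap n M P (f : 'I_n -> {linear M -> P}) :
  {linear {ffun 'I_n -> M} -> P}.
Proof.
apply: (@lin _ _ (fun x : {ffun 'I_n -> M} => \sum_i f i (x i))) => a x y.
rewrite scaler_sumr -big_split; apply: eq_bigr => i _ /=.
by rewrite !ffunE linearP.
Defined.

Definition proji n M (i : 'I_n) : {linear {ffun 'I_n -> M} -> M}.
Proof.
by apply: (@lin _ _ (fun x : {ffun 'I_n -> M} => x i)) => a x y; rewrite !ffunE.
Defined.

Definition inji n M (i : 'I_n) : {linear M -> {ffun 'I_n -> M}}.
Proof.
apply: (@lin _ _ (fun x => [ffun j => if j == i then x else 0])) => a x y.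
by apply/ffunP => j; rewrite !ffunE; case: eqP; rewrite // scaler0 addr0.
Defined.

Arguments inji {n M} i.
Arguments proji {n M} i.

Lemma ffun_sum_inji n M (x : {ffun 'I_n -> M}) : x = \sum_i inji i (x i).
Proof.
apply/ffunP => j; rewrite sum_ffunE (bigD1 j) //= ffunE eqxx big1 ?addr0 //.
by move=> i /negPf h; rewrite ffunE eq_sym h.
Qed.

Lemma retract_ffunS n M :
  retract {ffun 'I_n.+1 -> M} (M * {ffun 'I_n -> M})%type.
Proof.
have hl : linear (fun p : M * {ffun 'I_n -> M} =>
    [ffun i : 'I_n.+1 => oapp p.2 p.1 (unlift ord0 i)]).
  move=> a x y; apply/ffunP => i; rewrite !ffunE.
  by case: unliftP => [j|] _ /=; rewrite ?ffunE.
exists (pairmap (proji ord0) (fmap (fun i => proji (lift ord0 i)))), (lin hl) => y.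
by apply/ffunP => i; rewrite !ffunE; case: unliftP => [j|] -> //=; rewrite ffunE.
Qed.

End LinearMaps.

Arguments inji {R n M} i.
Arguments proji {R n M} i.

(** * Submodules and quotient modules *)

Section SubQuotient.
Variables (R : nzRingType) (M : lmodType R) (S : set M) (hS : submodule S).

Lemma submodule0 : S 0.
Proof. by case: hS => + _; rewrite inE. Qed.

Lemma submoduleP a x y : S x -> S y -> S (a *: x + y).
Proof. by move=> hx hy; case: hS => _ /(_ a x y); rewrite !inE; exact. Qed.

Lemma submoduleZ a x : S x -> S (a *: x).
Proof. by move=> hx; rewrite -[_ *: _]addr0; apply: submoduleP => //; exact: submodule0. Qed.

Lemma submoduleD x y : S x -> S y -> S (x + y).
Proof. by move=> hx; rewrite -[x]scale1r; exact: submoduleP. Qed.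

Lemma submoduleN x : S x -> S (- x).
Proof. by rewrite -scaleN1r; exact: submoduleZ. Qed.

Lemma submoduleB x y : S x -> S y -> S (x - y).
Proof. by move=> hx hy; apply: submoduleD => //; exact: submoduleN. Qed.

(** The proof that [S] is a submodule is an argument, so that the closure instance below can be
    attached to [subpred hS]. *)
Definition subpred of submodule S : {pred M} := fun x => `[< S x >].

Lemma subpred_closed : GRing.submod_closed (subpred hS).
Proof.
split; first exact/asboolP/submodule0.
by move=> a x y /asboolP hx /asboolP hy; exact/asboolP/submoduleP.
Qed.

HB.instance Definition _ :=
  GRing.isSubmodClosed.Build R M (subpred hS) subpred_closed.

Record submod := Submod { submod_val :> M; _ : submod_val \in subpred hS }.

HB.instance Definition _ := [isSub for submod_val].
HB.instance Definition _ := [Choice of submod by <:].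
HB.instance Definition _ := [SubChoice_isSubLmodule of submod by <:].

Lemma sub_exists :
  exists (X : lmodType R) (i : {linear X -> M}),
    injective i /\ forall y, S y <-> exists x, i x = y.
Proof.
have vl : linear submod_val by [].
exists submod, (lin vl); split; first exact: val_inj.
move=> y; split; last by move=> [[x xS] /= <-]; apply/asboolP.
by move=> /asboolP yS; exists (Submod yS).
Qed.

(** The set of candidates depends only on the coset of [x], hence so does the choice made by [xget].
    The quotient module is then the subtype [quo] of chosen representatives. *)
Definition coset_rep x : M := xget 0 [set y | S (x - y)]%classic.

Lemma coset_rep_sub x : S (x - coset_rep x).
Proof.
rewrite /coset_rep; case: xgetP => [y _ //|h].
by case: (h x); rewrite /= subrr; exact: submodule0.
Qed.

Lemma coset_rep_eq x y : S (x - y) -> coset_rep x = coset_rep y.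
Proof.
move=> h; congr xget; apply/seteqP; split => z /= hz.
  have -> : y - z = x - z - (x - y) by rewrite opprB [RHS]addrC addrA subrK.
  exact: submoduleB.
have -> : x - z = x - y + (y - z) by rewrite addrA subrK.
exact: submoduleD.
Qed.

Lemma coset_repK x : coset_rep (coset_rep x) = coset_rep x.
Proof.
apply: coset_rep_eq; rewrite -opprB; apply: submoduleN; exact: coset_rep_sub.
Qed.

Record quo (h : submodule S) :=
  Quo { quo_val :> M; _ : coset_rep quo_val == quo_val }.

Local Notation Q := (quo hS).
HB.instance Definition _ := [isSub for @quo_val hS].
HB.instance Definition _ := [Choice of Q by <:].

Definition quo_pi x : Q := Quo hS (introT eqP (coset_repK x)).

Lemma quo_piE x y : S (x - y) -> quo_pi x = quo_pi y.
Proof. by move=> h; apply: val_inj; exact: coset_rep_eq. Qed.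

Lemma quo_valK (u : Q) : quo_pi (val u) = u.
Proof. by apply: val_inj; case: u => x /= /eqP. Qed.

Definition quo_add (u v : Q) := quo_pi (val u + val v).
Definition quo_opp (u : Q) := quo_pi (- val u).
Definition quo_scale a (u : Q) := quo_pi (a *: val u).

Lemma quo_piD x y : quo_add (quo_pi x) (quo_pi y) = quo_pi (x + y).
Proof.
apply: quo_piE; rewrite -opprB; apply: submoduleN.
by rewrite opprD addrACA; apply: submoduleD; exact: coset_rep_sub.
Qed.

Lemma quo_piN x : quo_opp (quo_pi x) = quo_pi (- x).
Proof. by apply: quo_piE; rewrite opprK addrC; exact: coset_rep_sub. Qed.

Lemma quo_piZ a x : quo_scale a (quo_pi x) = quo_pi (a *: x).
Proof.
apply: quo_piE; rewrite -opprB -scalerBr; apply: submoduleN.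
exact/submoduleZ/coset_rep_sub.
Qed.

Lemma quo_addA : associative quo_add.
Proof.
move=> u v w; rewrite -(quo_valK u) -(quo_valK v) -(quo_valK w) !quo_piD.
by rewrite addrA.
Qed.
Lemma quo_addC : commutative quo_add.
Proof. by move=> u v; rewrite /quo_add addrC. Qed.
Lemma quo_add0 : left_id (quo_pi 0) quo_add.
Proof. by move=> u; rewrite -(quo_valK u) quo_piD add0r. Qed.
Lemma quo_addN : left_inverse (quo_pi 0) quo_opp quo_add.
Proof. by move=> u; rewrite -(quo_valK u) quo_piN quo_piD addNr. Qed.

HB.instance Definition _ :=
  GRing.isZmodule.Build Q quo_addA quo_addC quo_add0 quo_addN.

Lemma quo_scaleA a b u : quo_scale a (quo_scale b u) = quo_scale (a * b) u.
Proof. by rewrite -(quo_valK u) !quo_piZ scalerA. Qed.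
Lemma quo_scale1 : left_id 1 quo_scale.
Proof. by move=> u; rewrite -(quo_valK u) quo_piZ scale1r. Qed.
Lemma quo_scaleDr : right_distributive quo_scale +%R.
Proof.
move=> a u v; rewrite -(quo_valK u) -(quo_valK v).
by rewrite [X in quo_scale _ X]quo_piD !quo_piZ scalerDr [RHS]quo_piD.
Qed.
Lemma quo_scaleDl u : {morph quo_scale^~ u : a b / a + b}.
Proof.
move=> a b; rewrite -(quo_valK u) !quo_piZ scalerDl; exact/esym/quo_piD.
Qed.

HB.instance Definition _ := GRing.Zmodule_isLmodule.Build R Q
  quo_scaleA quo_scale1 quo_scaleDr quo_scaleDl.

Lemma quo_exists :
  exists (Z : lmodType R) (p : {linear M -> Z}),
    (forall z, exists y, p y = z) /\ forall y, p y = 0 <-> S y.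
Proof.
have pl : linear quo_pi.
  move=> a x y; rewrite -[RHS]/(quo_add (quo_scale a (quo_pi x)) (quo_pi y)).
  by rewrite quo_piZ quo_piD.
exists Q, (lin pl); split; first by move=> z; exists (val z); exact: quo_valK.
move=> y; split => /= [|yS]; last by apply: quo_piE; rewrite subr0.
move=> /(congr1 val) /= e; rewrite -(addrNK (coset_rep y) y).
apply: submoduleD; first exact: coset_rep_sub.
by have := submoduleN (coset_rep_sub 0); rewrite sub0r opprK e.
Qed.

End SubQuotient.

(** * Kernels, cokernels and images *)

Section KerCoker.
Variable R : nzRingType.
Implicit Types M N X Y Z : lmodType R.

Lemma ker_submodule M N (f : {linear M -> N}) : submodule (ker f).
Proof.
split; rewrite ?inE /ker /= ?linear0//.
by move=> a x y; rewrite !inE /= linearP => -> ->; rewrite scaler0 addr0.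
Qed.

Lemma range_submodule M N (f : {linear M -> N}) : submodule (range f).
Proof.
split; rewrite ?inE /=; first by exists 0; rewrite ?linear0.
move=> a u v; rewrite !inE => -[x _ <-] [y _ <-].
by exists (a *: x + y); rewrite ?linearP.
Qed.

Lemma ker_exists Y Z (p : {linear Y -> Z}) :
  exists X (i : {linear X -> Y}),
    injective i /\ forall y, p y = 0 <-> exists x, i x = y.
Proof. exact: sub_exists (ker_submodule p). Qed.

Lemma coker_exists X Y (i : {linear X -> Y}) : injective i ->
  exists Z (p : {linear Y -> Z}), ses i p.
Proof.
move=> ii; have [Z [p [ps pk]]] := quo_exists (range_submodule i).
exists Z, p; split => // y; rewrite pk; split => [[x _ <-]|[x <-]]; by exists x.
Qed.

Lemma im_exists M N (f : {linear M -> N}) :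
  exists Z (q : {linear M -> Z}) (j : {linear Z -> N}),
    [/\ forall z, exists x, q x = z, injective j & forall x, j (q x) = f x].
Proof.
have [Z [j [ji jr]]] := sub_exists (range_submodule f).
have [|q qE] := @factor_inj _ _ _ _ j f ji; first by move=> x; apply/jr; exists x.
exists Z, q, j; split => // z.
have /jr[x _ e] : exists z', j z' = j z by exists z.
by exists x; apply: ji; rewrite qE.
Qed.

End KerCoker.

Record fmod (R : nzRingType) := Fmod { fcar :> lmodType R; fmP : fg fcar }.

(** Take [B] of maximal rank among the matrices whose row space lies in [S]; adjoining a vector of
    [S] to [B] cannot raise the rank. *)
Lemma row_space_exists (K : fieldType) n (S : set 'rV[K]_n) :
  S 0 -> (forall a u v, S u -> S v -> S (a *: u + v)) ->
  exists B : 'M[K]_n, forall v, S v <-> (v <= B)%MS.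
Proof.
move=> S0 SP; pose good (B : 'M[K]_n) := forall v : 'rV_n, (v <= B)%MS -> S v.
have [r [[B [gB rB]] rmax]] : exists r, (exists B, good B /\ \rank B = r) /\
    forall B, good B -> (\rank B <= r)%N.
  have ex0 : exists r, `[< exists B, good B /\ \rank B = r >].
    exists 0%N; apply/asboolP; exists 0; split; last by rewrite mxrank0.
    by move=> v; rewrite submx0 => /eqP ->.
  have ub r : `[< exists B, good B /\ \rank B = r >] -> (r <= n)%N.
    by move=> /asboolP[B [_ <-]]; exact: rank_leq_row.
  have [r /asboolP h hm] := ex_maxnP ex0 ub; exists r; split => // B gB.
  by apply: hm; apply/asboolP; exists B.
exists B => v; split; last exact: gB.
move=> Sv; have gC : good (B + v)%MS.
  move=> w /sub_addsmxP[[a b] /= ->].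
  have /sub_rVP[c ->] : (b *m v <= v)%MS by exact: submxMl.
  by rewrite addrC; apply: SP => //; apply: gB; exact: submxMl.
have := rmax _ gC; rewrite -rB => le.
have := mxrank_leqif_sup (addsmxSl B v).
move=> /geq_leqif; rewrite le => /esym h; apply: submx_trans (addsmxSr B v) h.
Qed.

(** * Finite-dimensional algebras *)

(* R is a finite-dimensional K-algebra through iota; no algebra structure on R
   is required, so that R may be the converse ring of a falgType. *)
Section FiniteDim.
Variables (K : fieldType) (R : nzRingType) (iota : {rmorphism K -> R}).
Hypothesis iotaC : forall k r, iota k * r = r * iota k.
Hypothesis Rfin : exists n (b : 'I_n -> R), forall r, exists c : 'I_n -> K,
  r = \sum_i iota (c i) * b i.
Implicit Types M N X Y Z : lmodType R.

Definition kspan M (T : finType) (e : T -> M) : Prop :=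
  forall x, exists c : T -> K, x = \sum_i iota (c i) *: e i.

Lemma fg_kspan M : fg M -> exists n (e : 'I_n -> M), kspan e.
Proof.
move=> [m [g gP]]; have [n [b bP]] := Rfin.
suff [T [e eP]] : exists (T : finType) (e : T -> M), kspan e.
  exists #|T|, (fun i => e (enum_val i)) => x.
  have [c ->] := eP x; exists (fun i => c (enum_val i)).
  by rewrite (reindex (fun i : 'I_#|T| => enum_val i)) //; exact/onW_bij/enum_val_bij.
exists ('I_m * 'I_n)%type, (fun p => b p.2 *: g p.1) => x.
have [c ->] := gP x; have /choice[d dP] := fun i => bP (c i).
exists (fun p => d p.1 p.2); rewrite -(pair_bigA _
  (fun i j => iota (d i j) *: (b j *: g i))) /=; apply: eq_bigr => i _.
by rewrite {1}dP scaler_suml; apply: eq_bigr => j _; rewrite scalerA.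
Qed.

Definition kcoord M n (k : M -> 'rV[K]_n) : Prop :=
  bijective k /\ forall a x y, k (iota a *: x + y) = a *: k x + k y.

(** A spanning family of least size is a basis, since a nontrivial relation would allow one vector
    to be dropped. *)
Lemma coord_exists M : fg M -> exists n (k : M -> 'rV[K]_n), kcoord k.
Proof.
move=> /fg_kspan fM.
have ex : exists n, `[< exists e : 'I_n -> M, kspan e >].
  by have [n h] := fM; exists n; apply/asboolP.
have [n /asboolP[e eP] nmin] := ex_minnP ex.
pose f (v : 'rV[K]_n) := \sum_i iota (v 0 i) *: e i.
have fL a u v : f (a *: u + v) = iota a *: f u + f v.
  rewrite /f scaler_sumr -big_split /=; apply: eq_bigr => i _.
  by rewrite !mxE rmorphD rmorphM scalerDl scalerA.
have f0 v : f v = 0 -> v = 0.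
  move=> fv0; apply/eqP/negPn/negP => /rV0Pn[j vj].
  case: n e eP nmin @f fL v fv0 j vj => [|n] e eP nmin f fL v fv0 j vj; first by case: j {vj}.
  suff : (n.+1 <= n)%N by rewrite ltnn.
  apply: nmin; apply/asboolP; exists (fun i => e (lift j i)) => x.
  (* The relation [v] has a nonzero [j]-th coefficient; subtracting this multiple of it cancels the
     [j]-th coordinate without changing the vector represented. *)
  have [c xE] := eP x; pose w := \row_i c i - (c j / v 0 j) *: v.
  exists (fun i => w 0 (lift j i)).
  have -> : x = f w.
    rewrite /w addrC -scaleNr fL fv0 scaler0 add0r xE /f.
    by apply: eq_bigr => i _; rewrite mxE.
  rewrite /f (bigD1_ord j) //= [X in _ *: _ + X](_ : _ =
    \sum_i iota (w 0 (lift j i)) *: e (lift j i)) //.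
  by rewrite /w !mxE divfK // subrr rmorph0 scale0r add0r.
have fi : injective f.
  move=> u v e'; apply/eqP; rewrite -subr_eq0; apply/eqP/f0.
  have := fL (-1) v u; rewrite e' rmorphN1 scaleN1r scaleN1r addNr => <-.
  by rewrite addrC.
have fs x : exists v, f v = x.
  have [c ->] := eP x; exists (\row_i c i).
  by apply: eq_bigr => i _; rewrite mxE.
have /choice[k kP] := fs.
exists n, k; split; first by exists f => // v; apply: fi; rewrite kP.
by move=> a x y; apply: fi; rewrite fL !kP.
Qed.

Lemma coord_mx M N m n (k : M -> 'rV[K]_m) (l : N -> 'rV[K]_n) (f : M -> N) :
  kcoord k -> kcoord l ->
  (forall a x y, f (iota a *: x + y) = iota a *: f x + f y) ->
  exists F : 'M[K]_(m, n), forall x, l (f x) = k x *m F.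
Proof.
move=> [[k' k'K kK] kL] [_ lL] fL.
have gl : linear (fun v => l (f (k' v))).
  move=> a u v; rewrite -lL -fL; congr (l (f _)).
  by apply: (can_inj k'K); rewrite kL !kK.
exists (lin1_mx (lin gl)) => x; rewrite mul_rV_lin1 /= k'K //.
Qed.

Lemma klinear M N (f : {linear M -> N}) a x y :
  f (iota a *: x + y) = iota a *: f x + f y.
Proof. by rewrite linearP. Qed.

Lemma coord0 M n (k : M -> 'rV[K]_n) : kcoord k -> k 0 = 0.
Proof.
move=> [_ /(_ 1 0 0)]; rewrite rmorph1 !scale1r addr0.
by move=> /(congr1 (fun z => z - k 0)); rewrite subrr addrK.
Qed.

Lemma coord_eq0 M n (k : M -> 'rV[K]_n) x : kcoord k -> k x = 0 -> x = 0.
Proof. by move=> hk; rewrite -(coord0 hk); apply: bij_inj; case: hk. Qed.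

Lemma inj_mx M N m n (k : M -> 'rV[K]_m) (l : N -> 'rV[K]_n)
    (f : {linear M -> N}) (F : 'M[K]_(m, n)) :
  kcoord k -> kcoord l -> (forall x, l (f x) = k x *m F) ->
  injective f <-> row_free F.
Proof.
move=> hk hl FE; split => [fi|Ff].
  apply: inj_row_free => v; have [[k' k'K kK] _] := hk.
  rewrite -[v]kK -FE => /(coord_eq0 hl) /(inj0 fi) ->.
  exact: coord0.
apply: lin_inj => x fx0; apply: (coord_eq0 hk); apply: (row_free_inj Ff).
by rewrite mul0mx -FE fx0 (coord0 hl).
Qed.

Lemma surj_mx M N m n (k : M -> 'rV[K]_m) (l : N -> 'rV[K]_n)
    (f : {linear M -> N}) (F : 'M[K]_(m, n)) :
  kcoord k -> kcoord l -> (forall x, l (f x) = k x *m F) ->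
  (forall y, exists x, f x = y) <-> row_full F.
Proof.
move=> hk hl FE; have [[k' k'K kK] _] := hk; have [[l' l'K lK] _] := hl.
split => [fs|/submx_full Ff y].
  rewrite -sub1mx; apply/row_subP => i.
  have [x /(congr1 l)] := fs (l' (row i 1%:M)); rewrite FE lK => <-.
  exact: submxMl.
have /submxP[u uE] := Ff _ (l y).
by exists (k' u); apply: (can_inj l'K); rewrite FE kK.
Qed.

(** The dimension over K, read off a chosen coordinate system; it enters later arguments through the
    comparisons along injections and surjections below. *)
Definition kdim (M : fmod R) : nat := projT1 (cid (coord_exists (fmP M))).

Lemma kdimP (M : fmod R) : exists k : M -> 'rV[K]_(kdim M), kcoord k.
Proof. by rewrite /kdim; case: cid. Qed.

Lemma kdim_mx (M N : fmod R) (f : {linear M -> N}) :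
  exists F : 'M[K]_(kdim M, kdim N),
    (injective f <-> row_free F) /\ ((forall y, exists x, f x = y) <-> row_full F).
Proof.
have [k hk] := kdimP M; have [l hl] := kdimP N.
have [F FE] := coord_mx hk hl (klinear f).
by exists F; split; [exact: inj_mx FE|exact: surj_mx FE].
Qed.

Lemma kdim_inj (M N : fmod R) (f : {linear M -> N}) :
  injective f -> (kdim M <= kdim N)%N.
Proof.
have [F [-> _]] := kdim_mx f => /eqP <-; exact: rank_leq_col.
Qed.

Lemma kdim_surj (M N : fmod R) (f : {linear M -> N}) :
  (forall y, exists x, f x = y) -> (kdim N <= kdim M)%N.
Proof.
have [F [_ ->]] := kdim_mx f => /eqP <-; exact: rank_leq_row.
Qed.

Lemma kdim_inj_eq (M N : fmod R) (f : {linear M -> N}) :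
  injective f -> (kdim N <= kdim M)%N -> forall y, exists x, f x = y.
Proof.
move=> fi le; have := kdim_inj fi; have [F [Fi ->]] := kdim_mx f.
move: fi; rewrite Fi => /eqP Ff ge; apply/eqP; rewrite Ff.
by apply/eqP; rewrite eqn_leq ge.
Qed.

Lemma kdim_surj_eq (M N : fmod R) (f : {linear M -> N}) :
  (forall y, exists x, f x = y) -> (kdim M <= kdim N)%N -> injective f.
Proof.
move=> fs le; have := kdim_surj fs; have [F [-> Fs]] := kdim_mx f.
move: fs; rewrite Fs => /eqP Ff ge; apply/eqP; rewrite Ff.
by apply/eqP; rewrite eqn_leq ge.
Qed.

(** Over a finite-dimensional [R], finitely generated means finite-dimensional over K: the image of
    [f] is a row space in coordinates, and preimages of the rows of [B] generate [M]. *)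
Lemma fg_sub M N (f : {linear M -> N}) : injective f -> fg N -> fg M.
Proof.
move=> fi /coord_exists[n [k hk]]; have [[k' k'K kK] kL] := hk.
have [||B BP] := @row_space_exists _ _ (range (fun x => k (f x))).
- by exists 0; rewrite ?linear0 ?(coord0 hk).
- move=> a _ _ [x _ <-] [y _ <-]; exists (iota a *: x + y) => //.
  by rewrite linearP kL.
have /choice[e eP] i : exists x, k (f x) = row i B.
  by have /BP[x _ h] := row_sub i B; exists x.
exists n, e => x; have /BP/submxP[u uE] : range (fun x => k (f x)) (k (f x)).
  by exists x.
exists (fun i => iota (u 0 i)); apply: fi; apply: (can_inj k'K).
rewrite uE mulmx_sum_row linear_sum /=.
have kS (F : 'I_n -> N) : k (\sum_i F i) = \sum_i k (F i).
  apply: (big_ind2 (fun a b => k a = b)) => [|x1 x2 y1 y2 <- <-|//].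
    exact: coord0 hk.
  by have := kL 1 x1 y1; rewrite rmorph1 !scale1r.
rewrite kS; apply: eq_bigr => i _; rewrite linearZ /= -eP.
by have := kL (u 0 i) (f (e i)) 0; rewrite !addr0 (coord0 hk) addr0.
Qed.

Lemma fg_quo M N (f : {linear M -> N}) :
  (forall y, exists x, f x = y) -> fg M -> fg N.
Proof.
move=> fs [n [g gP]]; exists n, (fun i => f (g i)) => y.
have [x <-] := fs y; have [c ->] := gP x; exists c.
by rewrite linear_sum; apply: eq_bigr => i _; rewrite linearZ.
Qed.

(** The matrix [F] of [f] is row free, so [pinvmx F] is a right inverse of it; following it by [phi]
    gives the extension. *)
Lemma functional_ext M N (f : {linear M -> N}) (phi : M -> K) : fg M -> fg N ->
  injective f -> (forall a x y, phi (iota a *: x + y) = a * phi x + phi y) ->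
  exists psi : N -> K,
    (forall a x y, psi (iota a *: x + y) = a * psi x + psi y) /\
    forall x, psi (f x) = phi x.
Proof.
move=> /coord_exists[m [k hk]] /coord_exists[n [l hl]] fi pL.
have [F FE] := coord_mx hk hl (klinear f).
have Ff := iffLR (inj_mx hk hl FE) fi.
have [[k' k'K kK] kL] := hk.
have gl : linear (fun v => (phi (k' v))%:M : 'rV[K]_1).
  move=> a u v; rewrite -[u]kK -[v]kK -kL !k'K pL.
  by rewrite raddfD /= -scale_scalar_mx.
pose C := lin1_mx (lin gl).
exists (fun y => (l y *m (pinvmx F *m C)) 0 0); split => [a x y|x].
  by case: hl => _ ->; rewrite mulmxDl -scalemxAl !mxE.
rewrite FE mulmxA -[_ *m F *m _]mulmxA mulmxVp // mulmx1 mul_rV_lin1 /= k'K.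
by rewrite mxE eqxx mulr1n.
Qed.

(** A map is determined by its values on generators of [U], so Hom(U, V) becomes a subspace of a
    space of matrices, spanned by the rows of some [B]. Centrality of [iota] makes K-combinations of
    R-linear maps R-linear. *)
Lemma hom_fin (U V : fmod R) : exists m (h : 'I_m -> {linear U -> V}),
  forall f : {linear U -> V}, exists c : 'I_m -> K,
    forall x, f x = \sum_j iota (c j) *: h j x.
Proof.
have [r [u uP]] := fmP U; have [k hk] := kdimP V; have [[k' k'K kK] kL] := hk.
pose g (f : U -> V) : 'rV[K]_(r * kdim V) := mxvec (\matrix_i k (f (u i))).
have gL a f1 f2 : g (fun x => iota a *: f1 x + f2 x) = a *: g f1 + g f2.
  rewrite /g -linearP; congr mxvec; apply/row_matrixP => i.
  by rewrite linearP /= !rowK kL.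
have gI (f1 f2 : {linear U -> V}) : g f1 = g f2 -> forall x, f1 x = f2 x.
  move=> /(can_inj mxvecK) e x; have [c ->] := uP x.
  rewrite !linear_sum; apply: eq_bigr => i _; rewrite !linearZ /=; congr (_ *: _).
  by apply: (can_inj k'K); have /row_matrixP/(_ i) := e; rewrite !rowK.
have comb a (f1 f2 : {linear U -> V}) : linear (fun x => iota a *: f1 x + f2 x).
  by move=> b x y; rewrite !linearP !scalerDr !scalerA iotaC addrACA.
have g0 (f : U -> V) : (forall x, f x = 0) -> g f = 0.
  move=> f0; rewrite /g -[RHS](linear0 mxvec); congr mxvec.
  by apply/row_matrixP => i; rewrite rowK f0 row0 (coord0 hk).
have [||B BP] := @row_space_exists _ _ (range (fun f : {linear U -> V} => g f)).
- by exists \0%R => //; exact: g0.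
- by move=> a _ _ [f1 _ <-] [f2 _ <-]; exists (lin (comb a f1 f2)) => //=; rewrite -gL.
have /choice[h hP] i : exists f : {linear U -> V}, g f = row i B.
  by have /BP[x _ e] := row_sub i B; exists x.
exists (r * kdim V)%N, h => f.
have /BP/submxP[c cE] : range (fun f : {linear U -> V} => g f) (g f) by exists f.
exists (fun j => c 0 j).
have [s sE] : exists s : {linear U -> V}, forall x, s x = \sum_j iota (c 0 j) *: h j x.
  have sl : linear (fun x => \sum_j iota (c 0 j) *: h j x).
    move=> b x y; rewrite scaler_sumr -big_split; apply: eq_bigr => j _ /=.
    by rewrite linearP scalerDr !scalerA iotaC.
  by exists (lin sl).
move=> x; rewrite -sE; apply: gI; rewrite cE mulmx_sum_row.
rewrite (_ : g s = g (fun x => \sum_j iota (c 0 j) *: h j x)); last first.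
  by congr g; apply: funext.
elim: (index_enum _) => [|j js IH].
  by rewrite big_nil g0 // => y; rewrite big_nil.
rewrite big_cons IH -hP -gL; congr g; apply: funext => y.
by rewrite big_cons.
Qed.

Lemma fg_prod M N : fg M -> fg N -> fg (M * N)%type.
Proof.
move=> [m [g gP]] [n [h hP]].
exists (m + n)%N, (fun i => match split i with inl i => (g i, 0) | inr j => (0, h j) end).
case=> x y; have [c ->] := gP x; have [d ->] := hP y.
exists (fun i => match split i with inl i => c i | inr j => d j end).
have El i : split (lshift n i) = inl i :> 'I_m + 'I_n := unsplitK (inl i).
have Er i : split (rshift m i) = inr i :> 'I_m + 'I_n := unsplitK (inr i).
rewrite big_split_ord [RHS](_ : _ = \sum_i c i *: (g i, 0 : N) +
    \sum_j d j *: (0 : M, h j)); last first.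
  by congr (_ + _); apply: eq_bigr => i _; rewrite ?El ?Er.
apply/pair_equal_spec; split.
  rewrite (raddf_sum fst) (raddf_sum fst) /=.
  by rewrite [X in _ + X]big1 ?addr0 // => i _; rewrite scaler0.
rewrite (raddf_sum snd) (raddf_sum snd) /=.
by rewrite [X in X + _]big1 ?add0r // => i _; rewrite scaler0.
Qed.

Lemma fg_ffun n M : fg M -> fg {ffun 'I_n -> M}.
Proof.
move=> fM; elim: n => [|n IH].
  exists 0%N, (fun _ => 0) => x; exists (fun _ => 0).
  by rewrite big_ord0; apply/ffunP => -[].
have [s [r rs]] := retract_ffunS n M.
by apply: (fg_quo (f := r)) (fg_prod fM IH) => y; exists (s y).
Qed.

Lemma fg_reg : fg R^o.
Proof.
exists 1%N, (fun _ => 1) => x; exists (fun _ => x).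
by rewrite big_ord1 /GRing.scale /= mulr1.
Qed.

End FiniteDim.

(** * Projective and injective modules *)

Section ProjInj.
Variable R : nzRingType.
Implicit Types M N P I X Y Z : lmodType R.

Lemma projectiveP P (M N : fmod R) (g : {linear M -> N}) (f : {linear P -> N}) :
  projective P -> (forall y, exists x, g x = y) ->
  exists h : {linear P -> M}, forall x, g (h x) = f x.
Proof.
move=> pP gs; apply: pP; [exact: fmP|exact: fmP|].
by apply/seteqP; split => // y _; have [x <-] := gs y; exists x.
Qed.

Lemma injectiveP I (M N : fmod R) (g : {linear M -> N}) (f : {linear M -> I}) :
  injective_mod I -> injective g -> exists h : {linear N -> I}, forall x, h (g x) = f x.
Proof. by move=> iI gi; apply: iI => //; exact: fmP. Qed.

Lemma projective_retract P Q : retract P Q -> projective Q -> projective P.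
Proof.
move=> [s [r rs]] pQ M N fM fN g f gs.
have [h hE] := pQ M N fM fN g (f \o r) gs.
by exists (h \o s) => x /=; rewrite hE /= rs.
Qed.

Lemma injective_retract P Q : retract P Q -> injective_mod Q -> injective_mod P.
Proof.
move=> [s [r rs]] pQ M N fM fN g f gs.
have [h hE] := pQ M N fM fN g (s \o f) gs.
by exists (r \o h) => x /=; rewrite hE /= rs.
Qed.

Lemma projective_ffun n P : projective P -> projective {ffun 'I_n -> P}.
Proof.
move=> pP M N fM fN g f gs.
have /choice[h hE] := fun i : 'I_n => pP M N fM fN g (f \o inji i) gs.
exists (fsummap h) => x /=; rewrite linear_sum {2}(ffun_sum_inji x) linear_sum.
by apply: eq_bigr => i _; exact: hE.
Qed.

Lemma injective_ffun n I : injective_mod I -> injective_mod {ffun 'I_n -> I}.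
Proof.
move=> iI M N fM fN g f gi.
have /choice[h hE] := fun i : 'I_n => iI M N fM fN g (proji i \o f) gi.
by exists (fmap h) => x /=; apply/ffunP => i; rewrite ffunE hE.
Qed.

Lemma projective_prod P Q : projective P -> projective Q -> projective (P * Q)%type.
Proof.
move=> pP pQ M N fM fN g f gs.
have [u uE] := pP M N fM fN g (f \o linl P Q) gs.
have [v vE] := pQ M N fM fN g (f \o linr P Q) gs.
exists (copairmap u v) => -[x y] /=.
rewrite linearD uE vE /= -linearD; congr (f _).
by apply/pair_equal_spec; split; rewrite /= ?addr0 ?add0r.
Qed.

Lemma injective_prod I J :
  injective_mod I -> injective_mod J -> injective_mod (I * J)%type.
Proof.
move=> iI iJ M N fM fN g f gi.
have [u uE] := iI M N fM fN g (fst \o f) gi.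
have [v vE] := iJ M N fM fN g (snd \o f) gi.
by exists (pairmap u v) => x /=; rewrite uE vE /= -surjective_pairing.
Qed.

Lemma projective_reg : projective R^o.
Proof.
move=> M N fM fN g f gs.
have [m _ mE] : range g (f 1) by rewrite gs.
exists (scalemap m) => x /=; rewrite linearZ /= mE -linearZ /=.
by congr (f _); exact: mulr1.
Qed.

End ProjInj.

(** * The dual of the regular module; enough projectives and injectives *)

Section Dual.
Variables (K : fieldType) (R : nzRingType) (iota : {rmorphism K -> R}).
Hypothesis iotaC : forall k r, iota k * r = r * iota k.
Hypothesis Rfin : exists n (b : 'I_n -> R), forall r, exists c : 'I_n -> K,
  r = \sum_i iota (c i) * b i.

(** The K-dual D(R) = Hom_K(R, K), made a left module by (r f)(x) = f(x r). It serves as the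
    injective cogenerator. *)
Record rdual := Rdual {
  rdual_fun :> R -> K;
  rdual_lin : forall a x y, rdual_fun (iota a * x + y) = a * rdual_fun x + rdual_fun y
}.

Lemma rdualP (f g : rdual) : (forall x, f x = g x) -> f = g.
Proof.
case: f g => [f hf] [g hg] /= /funext fg; move: hf hg; rewrite fg => hf hg.
by congr Rdual; exact: Prop_irrelevance.
Qed.

HB.instance Definition _ := gen_eqMixin rdual.
HB.instance Definition _ := gen_choiceMixin rdual.

Definition rdual0 : rdual.
Proof. by apply: (@Rdual (fun _ => 0)) => a x y; rewrite mulr0 addr0. Defined.
Definition rdual_opp (f : rdual) : rdual.
Proof. by apply: (@Rdual (fun x => - f x)) => a x y; rewrite rdual_lin opprD mulrN. Defined.
Definition rdual_add (f g : rdual) : rdual.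
Proof.
by apply: (@Rdual (fun x => f x + g x)) => a x y; rewrite !rdual_lin mulrDr addrACA.
Defined.

Definition rdual_scale (r : R) (f : rdual) : rdual.
Proof.
by apply: (@Rdual (fun x => f (x * r))) => a x y; rewrite mulrDl -mulrA rdual_lin.
Defined.

Lemma rdual_addA : associative rdual_add.
Proof. by move=> f g h; apply: rdualP => x /=; rewrite addrA. Qed.
Lemma rdual_addC : commutative rdual_add.
Proof. by move=> f g; apply: rdualP => x /=; rewrite addrC. Qed.
Lemma rdual_add0 : left_id rdual0 rdual_add.
Proof. by move=> f; apply: rdualP => x /=; rewrite add0r. Qed.
Lemma rdual_addN : left_inverse rdual0 rdual_opp rdual_add.
Proof. by move=> f; apply: rdualP => x /=; rewrite addNr. Qed.

HB.instance Definition _ :=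
  GRing.isZmodule.Build rdual rdual_addA rdual_addC rdual_add0 rdual_addN.

Lemma rdualD (f : rdual) x y : f (x + y) = f x + f y.
Proof. by rewrite -{1}[x]mul1r -(rmorph1 iota) rdual_lin mul1r. Qed.

Lemma rdual_eq0 (f : rdual) : f 0 = 0.
Proof. by apply: (@addIr _ (f 0)); rewrite -rdualD addr0 add0r. Qed.

Lemma rdualZl (f : rdual) a x : f (iota a * x) = a * f x.
Proof. by rewrite -[_ * x]addr0 rdual_lin rdual_eq0 addr0. Qed.

Lemma rdual_scaleA a b f : rdual_scale a (rdual_scale b f) = rdual_scale (a * b) f.
Proof. by apply: rdualP => x /=; rewrite mulrA. Qed.
Lemma rdual_scale1 : left_id 1 rdual_scale.
Proof. by move=> f; apply: rdualP => x /=; rewrite mulr1. Qed.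
Lemma rdual_scaleDr : right_distributive rdual_scale +%R.
Proof. by move=> a f g; apply: rdualP. Qed.
Lemma rdual_scaleDl f : {morph rdual_scale^~ f : a b / a + b}.
Proof. by move=> a b; apply: rdualP => x /=; rewrite mulrDr rdualD. Qed.

HB.instance Definition _ := GRing.Zmodule_isLmodule.Build R rdual
  rdual_scaleA rdual_scale1 rdual_scaleDr rdual_scaleDl.

Lemma rdualDE (f g : rdual) x : (f + g) x = f x + g x. Proof. by []. Qed.
Lemma rdualZE r (f : rdual) x : (r *: f) x = f (x * r). Proof. by []. Qed.

Lemma rdual_sumE n (F : 'I_n -> rdual) x : (\sum_i F i) x = \sum_i F i x.
Proof. by elim/big_ind2: _ => // f a g b <- <-. Qed.

Lemma fg_rdual : fg rdual.
Proof.
have [n [k hk]] := coord_exists Rfin (fg_reg R).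
have [[k' k'K kK] kL] := hk.
have eL i a x y : k (iota a * x + y) 0 i = a * k x 0 i + k y 0 i.
  by have := kL a x y => /= ->; rewrite !mxE.
pose e i := Rdual (eL i); exists n, e => f.
exists (fun i => iota (f (k' (delta_mx 0 i)))); apply: rdualP => x.
rewrite rdual_sumE -{1}[x]k'K {1}(row_sum_delta (k x)).
have k'L a u v : k' (a *: u + v) = iota a * k' u + k' v.
  by apply: (can_inj k'K); rewrite kK [RHS]kL !kK.
have k'0 : k' 0 = 0 by rewrite -(coord0 hk) k'K.
under [RHS]eq_bigr => i _ do rewrite rdualZE -iotaC rdualZl.
elim: (index_enum _) => [|j js IH]; first by rewrite !big_nil k'0 rdual_eq0.
by rewrite !big_cons k'L rdual_lin IH mulrC.
Qed.

(** By Hom_R(M, D(R)) = Hom_K(M, K), evaluation at 1 reduces the extension problem to K-functionals;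
    an extended functional [psi] is turned back into the map sending y to (r -> psi(r y)). *)
Lemma injective_rdual : injective_mod rdual.
Proof.
move=> M N fM fN f g fi.
have [|psi [pL pE]] := functional_ext Rfin (phi := fun x => g x 1) fM fN fi.
  by move=> a x y; rewrite linearP rdualDE rdualZE -iotaC rdualZl.
have hL y a r s : psi ((iota a * r + s) *: y) = a * psi (r *: y) + psi (s *: y).
  by rewrite scalerDl -scalerA pL.
have hl : linear (fun y => Rdual (hL y)).
  move=> r x y; apply: rdualP => s; rewrite rdualDE rdualZE /= scalerDr scalerA.
  by have := pL 1 ((s * r) *: x) (s *: y); rewrite rmorph1 scale1r mul1r.
exists (lin hl) => x; apply: rdualP => r /=.
by rewrite -linearZ /= pE linearZ rdualZE mul1r.
Qed.

Definition freg : fmod R := Fmod (fg_reg R).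
Definition fprod (M N : fmod R) : fmod R := Fmod (fg_prod (fmP M) (fmP N)).
Definition fpow n (M : fmod R) : fmod R := Fmod (fg_ffun n (fmP M)).

Lemma free_cover (M : fmod R) : exists n (p : {linear fpow n freg -> M}),
  forall y, exists x, p x = y.
Proof.
have [n [g gP]] := fmP M.
exists n, (fsummap (fun i => scalemap (g i))) => y; have [c ->] := gP y.
by exists [ffun i => c i]; apply: eq_bigr => i _ /=; rewrite ffunE.
Qed.

Lemma projective_fpow_reg n : projective (fpow n freg).
Proof. exact/projective_ffun/projective_reg. Qed.

Definition frdual : fmod R := Fmod fg_rdual.

Lemma injective_fpow_rdual n : injective_mod (fpow n frdual).
Proof. exact/injective_ffun/injective_rdual. Qed.

(** Each K-coordinate of [M] corresponds to a map into D(R); evaluating all of them at 1 recovers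
    the coordinates. *)
Lemma cofree_hull (M : fmod R) :
  exists n (f : {linear M -> fpow n frdual}), injective f.
Proof.
have [n [k hk]] := coord_exists Rfin (fmP M); have [_ kL] := hk.
have eL x i a r s : k ((iota a * r + s) *: x) 0 i = a * k (r *: x) 0 i + k (s *: x) 0 i.
  by rewrite scalerDl -scalerA kL !mxE.
have el i : linear (fun x => Rdual (eL x i)).
  move=> r x y; apply: rdualP => s; rewrite rdualDE rdualZE /= scalerDr scalerA.
  by have := kL 1 ((s * r) *: x) (s *: y); rewrite rmorph1 !scale1r => ->; rewrite mxE.
exists n, (fmap (fun i => lin (el i))).
apply: lin_inj => x /= /ffunP h; apply: (coord_eq0 hk); apply/rowP => i.
have := h i; rewrite !ffunE => /(congr1 (fun f : rdual => f 1)) /=.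
by rewrite scale1r mxE.
Qed.

Lemma ker_fmod (Y Z : fmod R) (p : {linear Y -> Z}) :
  exists (X : fmod R) (i : {linear X -> Y}),
    injective i /\ forall y, p y = 0 <-> exists x, i x = y.
Proof.
have [X [i [ii ie]]] := ker_exists p.
by exists (Fmod (fg_sub Rfin ii (fmP Y))), i.
Qed.

Lemma ker_ses (Y Z : fmod R) (p : {linear Y -> Z}) :
  (forall z, exists y, p y = z) -> exists (X : fmod R) (i : {linear X -> Y}), ses i p.
Proof.
by move=> ps; have [X [i [ii ie]]] := ker_fmod p; exists X, i; split.
Qed.

Lemma coker_ses (X Y : fmod R) (i : {linear X -> Y}) : injective i ->
  exists (Z : fmod R) (p : {linear Y -> Z}), ses i p.
Proof.
move=> /coker_exists[Z [p sp]]; have [_ ps _] := sp.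
by exists (Fmod (fg_quo ps (fmP Y))), p.
Qed.

Lemma im_fmod (M N : fmod R) (f : {linear M -> N}) :
  exists (Z : fmod R) (q : {linear M -> Z}) (j : {linear Z -> N}),
    [/\ forall z, exists x, q x = z, injective j & forall x, j (q x) = f x].
Proof.
have [Z [q [j [qs ji e]]]] := im_exists f.
by exists (Fmod (fg_quo qs (fmP M))), q, j.
Qed.

Lemma syz_exists (M : fmod R) : exists (X P : fmod R)
  (i : {linear X -> P}) (p : {linear P -> M}), ses i p /\ projective P.
Proof.
have [n [p ps]] := free_cover M; have [X [i s]] := ker_ses ps.
by exists X, (fpow n freg), i, p; split => //; exact: projective_fpow_reg.
Qed.

Lemma cosyz_exists (M : fmod R) : exists (I Z : fmod R)
  (i : {linear M -> I}) (p : {linear I -> Z}), ses i p /\ injective_mod I.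
Proof.
have [n [i ii]] := cofree_hull M; have [Z [p s]] := coker_ses ii.
by exists (fpow n frdual), Z, i, p; split => //; exact: injective_fpow_rdual.
Qed.

End Dual.

(** * Vanishing of Ext *)

Section Ext.
Variables (K : fieldType) (R : nzRingType) (iota : {rmorphism K -> R}).
Hypothesis iotaC : forall k r, iota k * r = r * iota k.
Hypothesis Rfin : exists n (b : 'I_n -> R), forall r, exists c : 'I_n -> K,
  r = \sum_i iota (c i) * b i.
Implicit Types M N X Y Z P I J L W : fmod R.

Let syz := syz_exists Rfin.
Let cosyz := cosyz_exists iotaC Rfin.

(** The vanishing of Ext^1(M, N), tested on every projective presentation of [M]; by [ext1_of_proj]
    one presentation suffices. *)
Definition ext1 M N : Prop :=
  forall X P (i : {linear X -> P}) (p : {linear P -> M}),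
  ses i p -> projective P -> forall f : {linear X -> N},
  exists g : {linear P -> N}, forall x, g (i x) = f x.

(** Lift [f] along the presentation to [v : P -> J]. Its restriction to [X] lands in [N];
    subtracting an extension of this restriction makes [v] descend to [M]. *)
Lemma lifts_of_extends X P M N (i : {linear X -> P}) (p : {linear P -> M}) :
  ses i p -> projective P ->
  (forall f : {linear X -> N}, exists g : {linear P -> N}, forall x, g (i x) = f x) ->
  forall J L (j : {linear N -> J}) (q : {linear J -> L}), ses j q ->
  forall f : {linear M -> L}, exists g : {linear M -> J}, forall x, q (g x) = f x.
Proof.
move=> sM pP h J L j q sN f; have [ii ps pk] := sM; have [ji qs qk] := sN.
have [v vE] := projectiveP (f \o p) pP qs.
have [|w wE] := @factor_inj _ _ _ _ j (v \o i) ji.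
  by move=> x; apply/qk; rewrite /= vE /= (ses_comp _ sM) linear0.
have [g gE] := h w.
have [|u uE] := @factor_surj _ _ _ _ p (v \- (j \o g)) ps.
  by move=> _ /pk[x <-] /=; rewrite gE wE subrr.
exists u => x; have [y <-] := ps x.
by rewrite uE /= linearB /= vE (ses_comp _ sN) subr0.
Qed.

(** The dual chase, with injectivity of [J] supplying the first extension; together with the
    previous lemma it lets Ext^1 be tested in either variable. *)
Lemma ext1_of_inj N J L M (j : {linear N -> J}) (q : {linear J -> L}) :
  ses j q -> injective_mod J ->
  (forall f : {linear M -> L}, exists g : {linear M -> J}, forall x, q (g x) = f x) ->
  ext1 M N.
Proof.
move=> sN iJ h X P i p sM pP f; have [ii ps pk] := sM; have [ji qs qk] := sN.
have [v vE] := injectiveP (j \o f) iJ ii.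
have [|w wE] := @factor_surj _ _ _ _ p (q \o v) ps.
  by move=> _ /pk[x <-] /=; rewrite vE /= (ses_comp _ sN).
have [g gE] := h w.
have [|u uE] := @factor_inj _ _ _ _ j (v \- (g \o p)) ji.
  by move=> x; apply/qk; rewrite /= linearB /= gE wE subrr.
exists u => x; apply: ji.
by rewrite uE /= (ses_comp _ sM) linear0 subr0 vE.
Qed.

Lemma ext1_inj N J L M (j : {linear N -> J}) (q : {linear J -> L}) :
  ext1 M N -> ses j q ->
  forall f : {linear M -> L}, exists g : {linear M -> J}, forall x, q (g x) = f x.
Proof.
move=> h; have [X [P [i [p [s pP]]]]] := syz M.
exact: lifts_of_extends s pP (h _ _ _ _ s pP) _ _ _ _.
Qed.

Lemma ext1_of_proj X P M N (i : {linear X -> P}) (p : {linear P -> M}) :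
  ses i p -> projective P ->
  (forall f : {linear X -> N}, exists g : {linear P -> N}, forall x, g (i x) = f x) ->
  ext1 M N.
Proof.
move=> s pP h; have [J [L [j [q [sN iJ]]]]] := cosyz N.
exact: ext1_of_inj sN iJ (lifts_of_extends s pP h sN).
Qed.

(** With [X] a syzygy of [M] and [L] a cosyzygy of [N], both sides express Ext^2(M, N) = 0. *)
Lemma ext1_balance X P M N J L (i : {linear X -> P}) (p : {linear P -> M})
    (j : {linear N -> J}) (q : {linear J -> L}) :
  ses i p -> projective P -> ses j q -> injective_mod J ->
  ext1 X N <-> ext1 M L.
Proof.
move=> sM pP sN iJ; have [ii _ _] := sM; have [_ qs _] := sN; split => h.
  apply: (ext1_of_proj sM pP) => f.
  have [g gE] := ext1_inj h sN f; have [u uE] := injectiveP g iJ ii.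
  by exists (q \o u) => x /=; rewrite uE gE.
apply: (ext1_of_inj sN iJ) => f.
have [g gE] := h _ _ _ _ sM pP f; have [u uE] := projectiveP g pP qs.
by exists (u \o i) => x /=; rewrite uE gE.
Qed.

(* The degree is shifted: [ext n M N] stands for Ext^{n+1}(M, N) = 0. *)
Fixpoint ext n M N : Prop :=
  if n is n'.+1 then
    exists X P (i : {linear X -> P}) (p : {linear P -> M}),
      [/\ ses i p, projective P & ext n' X N]
  else ext1 M N.

Lemma ext_cosyz n M N J L (j : {linear N -> J}) (q : {linear J -> L}) :
  ses j q -> injective_mod J -> ext n.+1 M N <-> ext n M L.
Proof.
move=> sN iJ; elim: n M => [|n IH] M.
  split => [[X [P [i [p [s pP h]]]]]|h]; first exact/(ext1_balance s pP sN iJ).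
  have [X [P [i [p [s pP]]]]] := syz M; exists X, P, i, p; split => //.
  exact/(ext1_balance s pP sN iJ).
split => [[X [P [i [p [s pP /IH h]]]]]|[X [P [i [p [s pP /IH h]]]]]];
  by exists X, P, i, p; split.
Qed.

(** The presentation hidden in [ext n.+1 M N] is arbitrary; shifting in the injective variable
    replaces it by the given one. *)
Lemma ext_syz n X P M N (i : {linear X -> P}) (p : {linear P -> M}) :
  ses i p -> projective P -> ext n.+1 M N <-> ext n X N.
Proof.
move=> s pP; split => [|h]; last by exists X, P, i, p; split.
elim: n N => [|n IH] N h; have [J [L [j [q [sN iJ]]]]] := cosyz N.
  exact/(ext1_balance s pP sN iJ)/(ext_cosyz 0 M sN iJ).
exact/(ext_cosyz n X sN iJ)/IH/(ext_cosyz _ M sN iJ).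
Qed.

Lemma ext_injective n M N : injective_mod N -> ext n M N.
Proof.
move=> iN; elim: n M => [|n IH] M.
  by move=> X P i p [ii _ _] _ f; exact: injectiveP f iN ii.
by have [X [P [i [p [s pP]]]]] := syz M; exists X, P, i, p; split.
Qed.

Lemma ext_projective n M N : projective M -> ext n M N.
Proof.
move=> pM; elim: n N => [|n IH] N; have [J [L [j [q [sN iJ]]]]] := cosyz N.
  have [_ qs _] := sN; apply: (ext1_of_inj sN iJ) => f.
  exact: projectiveP f pM qs.
exact/(ext_cosyz n M sN iJ).
Qed.

(** This is the exact piece Ext^{n+1}(Y, N) -> Ext^{n+1}(X, N) -> Ext^{n+2}(Z, N). After shifting
    [N] down to n = 0, a map X -> L extends to [Y] because Ext^1(Z, L) = 0, and the extension lifts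
    to [J] because Ext^1(Y, N) = 0. *)
Lemma ext_les_left n X Y Z N (i : {linear X -> Y}) (p : {linear Y -> Z}) :
  ses i p -> ext n Y N -> ext n.+1 Z N -> ext n X N.
Proof.
move=> s; elim: n N => [|n IH] N; have [J [L [j [q [sN iJ]]]]] := cosyz N; last first.
  move=> /(ext_cosyz n Y sN iJ) hY /(ext_cosyz n.+1 Z sN iJ) hZ.
  exact/(ext_cosyz n X sN iJ)/IH.
move=> hY /(ext_cosyz 0 Z sN iJ) hZ; apply: (ext1_of_inj sN iJ) => f.
have [J' [L' [j' [q' [sL iJ']]]]] := cosyz L; have [ji qs qk] := sL.
have [ii ps pk] := s.
have [v vE] := injectiveP (j' \o f) iJ' ii.
have [|w wE] := @factor_surj _ _ _ _ p (q' \o v) ps.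
  by move=> _ /pk[x <-] /=; rewrite vE /= (ses_comp _ sL).
have [g gE] := ext1_inj hZ sL w.
have [|u uE] := @factor_inj _ _ _ _ j' (v \- (g \o p)) ji.
  by move=> x; apply/qk; rewrite /= linearB /= gE wE subrr.
have [t tE] := ext1_inj hY sN u.
exists (t \o i) => x /=; rewrite tE; apply: ji.
by rewrite uE /= (ses_comp _ s) linear0 subr0 vE.
Qed.

(** The dual exact piece Ext^{n+1}(X, W) -> Ext^{n+1}(X, N) -> Ext^{n+2}(X, L), with the shift made
    in [X]. *)
Lemma ext_les_right n X L W N (j : {linear L -> W}) (q : {linear W -> N}) :
  ses j q -> ext n X W -> ext n.+1 X L -> ext n X N.
Proof.
move=> s; elim: n X => [|n IH] X; have [Y [P [i [p [sX pP]]]]] := syz X; last first.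
  move=> /(ext_syz n W sX pP) hW /(ext_syz n.+1 L sX pP) hL.
  exact/(ext_syz n N sX pP)/IH.
move=> hW /(ext_syz 0 L sX pP) hL; apply: (ext1_of_proj sX pP) => f.
have [Y' [P' [i' [p' [sY pP']]]]] := syz Y; have [ii ps pk] := sY.
have [ji qs qk] := s.
have [v vE] := projectiveP (f \o p') pP' qs.
have [|w wE] := @factor_inj _ _ _ _ j (v \o i') ji.
  by move=> x; apply/qk; rewrite /= vE /= (ses_comp _ sY) linear0.
have [g gE] := hL _ _ _ _ sY pP' w.
have [|u uE] := @factor_surj _ _ _ _ p' (v \- (j \o g)) ps.
  by move=> _ /pk[x <-] /=; rewrite gE wE subrr.
have [t tE] := hW _ _ _ _ sX pP u.
exists (q \o t) => x /=; rewrite tE; have [y <-] := ps x.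
by rewrite uE /= linearB /= vE (ses_comp _ s) subr0.
Qed.

Lemma ext_pow n m X N : ext n X N -> ext n X (fpow m N).
Proof.
elim: n X => [|n IH] X /=; last first.
  by move=> [Y [P [i [p [s pP h]]]]]; exists Y, P, i, p; split => //; exact: IH.
move=> h Y P i p s pP f.
have /choice[g gE] := fun k => h _ _ _ _ s pP (proji k \o f).
by exists (fmap g) => x /=; apply/ffunP => k; rewrite ffunE gE.
Qed.

(** For the kernel [X] of a projective presentation, the identity of [X] extends, which splits the
    presentation. *)
Lemma ext1_projective M : (forall N, ext1 M N) -> projective M.
Proof.
move=> h; have [X [P [i [p [s pP]]]]] := syz M; have [ii ps pk] := s.
have [r rE] := h X _ _ _ _ s pP idfun.
have [|u uE] := @factor_surj _ _ _ _ p (idfun \- (i \o r)) ps.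
  by move=> _ /pk[x <-] /=; rewrite rE subrr.
apply: projective_retract pP; exists u, p => x; have [y <-] := ps x.
by rewrite uE linearB /= (ses_comp _ s) subr0.
Qed.

Lemma ext1_injective N : (forall M, ext1 M N) -> injective_mod N.
Proof.
move=> h; have [J [L [j [q [s iJ]]]]] := cosyz N; have [ji qs qk] := s.
have [g gE] := ext1_inj (h L) s idfun.
have [|u uE] := @factor_inj _ _ _ _ j (idfun \- (g \o q)) ji.
  by move=> x; apply/qk; rewrite /= linearB /= gE subrr.
apply: injective_retract iJ; exists j, u => x; apply: ji.
by rewrite uE /= (ses_comp _ s) linear0 subr0.
Qed.

(** Because of the shift in [ext], this is Ext^{n+1}(M, -) = 0, that is, projective dimension at
    most n; [idle] is the same for injective dimension. Lemmas [projdim_leP] and [injdim_leP] make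
    the link with resolutions. *)
Definition pdle n M : Prop := forall N, ext n M N.
Definition idle n N : Prop := forall M, ext n M N.

Lemma pdle0 M : pdle 0 M <-> projective M.
Proof. by split => [/ext1_projective//|h N]; exact: (ext_projective 0). Qed.

Lemma idle0 M : idle 0 M <-> injective_mod M.
Proof. by split => [/ext1_injective//|h N]; exact: (ext_injective 0). Qed.

Lemma pdle_syz n X P M (i : {linear X -> P}) (p : {linear P -> M}) :
  ses i p -> projective P -> pdle n.+1 M <-> pdle n X.
Proof. by move=> s pP; split => h N; apply/(ext_syz n N s pP)/h. Qed.

Lemma idle_cosyz n N J L (j : {linear N -> J}) (q : {linear J -> L}) :
  ses j q -> injective_mod J -> idle n.+1 N <-> idle n L.
Proof. by move=> s iJ; split => h M; apply/(ext_cosyz n M s iJ)/h. Qed.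

Lemma pdleS n M : pdle n M -> pdle n.+1 M.
Proof.
move=> h N; have [J [L [j [q [s iJ]]]]] := cosyz N.
exact/(ext_cosyz n M s iJ).
Qed.

Lemma idleS n N : idle n N -> idle n.+1 N.
Proof.
move=> h M; have [X [P [i [p [s pP]]]]] := syz M.
exact/(ext_syz n N s pP).
Qed.

Lemma pdle_leq m n M : (m <= n)%N -> pdle m M -> pdle n M.
Proof. by move=> /subnK <- h; elim: (n - m)%N => // k /pdleS. Qed.

Lemma idle_leq m n M : (m <= n)%N -> idle m M -> idle n M.
Proof. by move=> /subnK <- h; elim: (n - m)%N => // k /idleS. Qed.

End Ext.

(** * Torsion with respect to the projective-injective modules *)

Section Torsion.
Variables (K : fieldType) (R : nzRingType) (iota : {rmorphism K -> R}).
Hypothesis iotaC : forall k r, iota k * r = r * iota k.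
Hypothesis Rfin : exists n (b : 'I_n -> R), forall r, exists c : 'I_n -> K,
  r = \sum_i iota (c i) * b i.
Implicit Types M N X Y Z P Q I J L W C U V : fmod R.

Definition pinj Q : Prop := projective Q /\ injective_mod Q.

Lemma pinj_prod P Q : pinj P -> pinj Q -> pinj (fprod P Q).
Proof.
by move=> [pP iP] [pQ iQ]; split; [exact: projective_prod|exact: injective_prod].
Qed.

Lemma pinj_pow n P : pinj P -> pinj (fpow n P).
Proof.
by move=> [pP iP]; split; [exact: projective_ffun|exact: injective_ffun].
Qed.

Lemma trivial_projective (P : lmodType R) : trivial_mod P -> projective P.
Proof.
by move=> tP M N _ _ g f _; exists \0%R => x; rewrite (tP x) !linear0.
Qed.

Lemma trivial_injective (I : lmodType R) : trivial_mod I -> injective_mod I.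
Proof.
by move=> tP M N _ _ g f _; exists \0%R => x; rewrite (tP (f x)).
Qed.

Definition fzero : fmod R := fpow 0 (freg R).

Lemma fzero_trivial : trivial_mod fzero.
Proof. by move=> x; apply/ffunP => -[]. Qed.

Lemma pinj_fzero : pinj fzero.
Proof.
by split; [apply: trivial_projective|apply: trivial_injective]; exact: fzero_trivial.
Qed.

Definition tors M : Prop :=
  forall Q, pinj Q -> forall (f : {linear M -> Q}) x, f x = 0.
Definition cotors M : Prop :=
  forall Q, pinj Q -> forall (f : {linear Q -> M}) x, f x = 0.

Definition torsionless M : Prop :=
  exists Q (j : {linear M -> Q}), pinj Q /\ injective j.
Definition cotorsionless M : Prop :=
  exists Q (p : {linear Q -> M}), pinj Q /\ forall y, exists x, p x = y.

(* These ask for a coresolution, respectively a resolution, whose first n terms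
   are projective-injective; it need not be minimal. *)
Fixpoint domge n M : Prop :=
  if n is n'.+1 then
    exists Q C (j : {linear M -> Q}) (q : {linear Q -> C}),
      [/\ ses j q, pinj Q & domge n' C]
  else True.

Fixpoint codge n M : Prop :=
  if n is n'.+1 then
    exists X Q (i : {linear X -> Q}) (p : {linear Q -> M}),
      [/\ ses i p, pinj Q & codge n' X]
  else True.

(** Shifting [N] reduces to k = 0. There the cosyzygy [C] still embeds in a projective-injective
    module, so Hom(X, C) = 0 and every map X -> C lifts trivially; this is why two steps beyond k
    are required. *)
Lemma ext_domge k X N : tors X -> domge k.+2 N -> ext k X N.
Proof.
move=> tX; elim: k N => [|k IH] N [Q [C [j [q [s pQ hC]]]]].
  have [Q' [_ [j' [_ [[ji' _ _] pQ' _]]]]] := hC.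
  apply: (ext1_of_inj s pQ.2) => f.
  exists \0%R => x; rewrite linear0; apply/esym/(inj0 ji').
  exact: (tX _ pQ' (j' \o f)).
by apply/(ext_cosyz iotaC Rfin k X s pQ.2)/IH.
Qed.

Lemma ext_codge k Y I : cotors Y -> codge k.+2 I -> ext k I Y.
Proof.
move=> tY; elim: k I => [|k IH] I [X [Q [i [p [s pQ hX]]]]].
  have [_ [Q' [_ [p' [[_ ps' _] pQ' _]]]]] := hX.
  apply: (ext1_of_proj iotaC Rfin s pQ.1) => f.
  exists \0%R => x; have [y <-] := ps' x; apply/esym.
  exact: (tY _ pQ' (f \o p')).
by apply/(ext_syz iotaC Rfin k Y s pQ.1)/IH.
Qed.

Lemma kdim_min (C : fmod R -> Prop) : (exists M, C M) ->
  exists M, C M /\ forall N, C N -> (kdim Rfin M <= kdim Rfin N)%N.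
Proof.
move=> [M CM].
have ex : exists n, `[< exists M, C M /\ kdim Rfin M = n >].
  by exists (kdim Rfin M); apply/asboolP; exists M.
have [_ /asboolP[X [CX <-]] h] := ex_minnP ex.
by exists X; split => // N CN; apply: h; apply/asboolP; exists N.
Qed.

(* The kernel of least dimension of a map from M to a projective-injective Q is
   torsion, since a nonzero map from it to Q' extends to M and would cut it
   down. *)
Lemma torsion_ses M : exists X Z (i : {linear X -> M}) (p : {linear M -> Z}),
  [/\ ses i p, tors X & torsionless Z].
Proof.
pose C X := exists Q (i : {linear X -> M}) (f : {linear M -> Q}),
  [/\ injective i, forall y, f y = 0 <-> exists x, i x = y & pinj Q].
have [|X [[Q [i [f [ii fk pQ]]]] Xmin]] := @kdim_min C.
  exists M, fzero, idfun, \0%R; split => //; last exact: pinj_fzero.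
  by move=> y; split => // _; exists y.
have [Z [q [j [qs ji jq]]]] := im_fmod f.
exists X, Z, i, q; split; last by exists Q, j.
  split => // y; rewrite -fk -jq; split => [->|/(inj0 ji)//]; exact: linear0.
move=> Q' pQ' g x; have [g' g'E] := injectiveP g pQ'.2 ii.
have [X2 [i2 [i2i i2k]]] := ker_fmod Rfin (Y := M) (Z := fprod Q Q') (pairmap f g').
have k2 y : i2 y = i2 y -> f (i2 y) = 0 /\ g' (i2 y) = 0.
  by move=> _; have /i2k/= [-> ->] : exists x, i2 x = i2 y by exists y.
have [|t tE] := @factor_inj _ _ _ _ i i2 ii.
  by move=> y; apply/fk; case: (k2 y erefl).
have ti : injective t by move=> a b /(congr1 i); rewrite !tE => /i2i.
have [|y <-] := kdim_inj_eq (Rfin := Rfin) ti _ x; last first.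
  by rewrite -g'E tE; case: (k2 y erefl).
by apply: Xmin; exists (fprod Q Q'), i2, (pairmap f g'); split => //; exact: pinj_prod.
Qed.

(** Dually, take a cokernel of least dimension of a map to [M] from a projective-injective [Q]: a
    nonzero map to it from [Q'] lifts to [M] and would shrink the cokernel further. *)
Lemma cotorsion_ses M : exists X Z (i : {linear X -> M}) (p : {linear M -> Z}),
  [/\ ses i p, cotorsionless X & cotors Z].
Proof.
have coker Q (f : {linear Q -> M}) : exists Z (p : {linear M -> Z}),
    (forall z, exists y, p y = z) /\ forall y, p y = 0 <-> exists x, f x = y.
  have [W [q [j [qs ji jq]]]] := im_fmod f.
  have [Z [p [_ ps pk]]] := coker_ses ji; exists Z, p; split => // y.
  rewrite pk; split => [[w <-]|[x <-]]; last by exists (q x).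
  by have [x <-] := qs w; exists x.
pose C Z := exists Q (f : {linear Q -> M}) (p : {linear M -> Z}),
  [/\ forall z, exists y, p y = z, forall y, p y = 0 <-> exists x, f x = y & pinj Q].
have [|Z [[Q [f [p [ps pk pQ]]]] Zmin]] := @kdim_min C.
  have [Z [p [ps pk]]] := coker fzero \0%R.
  by exists Z, fzero, \0%R, p; split => //; exact: pinj_fzero.
have [X [q [j [qs ji jq]]]] := im_fmod f.
exists X, Z, j, p; split; last 2 first.
- by exists Q, q.
- move=> Q' pQ' g x; have [g' g'E] := projectiveP g pQ'.1 ps.
  have [Z2 [p2 [p2s p2k]]] := coker (fprod Q Q') (copairmap f g').
  have [|t tE] := @factor_surj _ _ _ _ p p2 ps.
    by move=> _ /pk[y <-]; apply/p2k; exists (y, 0); rewrite /= linear0 addr0.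
  have ts z : exists y, t y = z by have [y <-] := p2s z; exists (p y).
  have ti : injective t.
    apply: (kdim_surj_eq (Rfin := Rfin) ts); apply: Zmin.
    by exists (fprod Q Q'), (copairmap f g'), p2; split => //; exact: pinj_prod.
  apply: (inj0 ti); rewrite -g'E tE; apply/p2k; exists (0, x).
  by rewrite /= linear0 add0r.
split => // y; rewrite pk; split => [[x <-]|[x <-]]; first by exists (q x).
by have [w <-] := qs x; exists w.
Qed.

Lemma ext_retract n X N N' : retract N N' -> ext n X N' -> ext n X N.
Proof.
move=> [s [r rs]]; elim: n X => [|n IH] X /=; last first.
  by move=> [Y [P [i [p [sX pP h]]]]]; exists Y, P, i, p; split => //; exact: IH.
move=> h Y P i p sX pP f; have [g gE] := h _ _ _ _ sX pP (s \o f).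
by exists (r \o g) => x /=; rewrite gE /= rs.
Qed.

(** * Consequences of a coresolution of the regular module by projective-injectives *)

Section Coresolution.
Variables (e : nat) (C Q : nat -> fmod R).
Variables (c : forall n, {linear C n -> Q n}) (q : forall n, {linear Q n -> C n.+1}).
Hypothesis cq : forall n, ses (c n) (q n).
Hypothesis pQ : forall n, (n < e.+2)%N -> pinj (Q n).
Hypothesis C0 : isomorphic (freg R) (C 0).
Hypothesis gldimR : forall M N, ext e.+2 M N.

Lemma domge_coresolution k n : (k + n <= e.+2)%N -> domge n (C k).
Proof.
elim: n k => // n IH k h; exists (Q k), (C k.+1), (c k), (q k); split => //.
  by apply: pQ; apply: leq_trans h; rewrite addnS ltnS leq_addr.
by apply: IH; rewrite addSnnS.
Qed.

(** Cover [N] by a free module with kernel [L]. Then Ext^{k+1}(X, N) lies between Ext^{k+1}(X,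
    free), zero by the dominant dimension, and Ext^{k+2}(X, L), zero by the bound on [X]. *)
Lemma tors_pdle k X : (k <= e)%N -> tors X -> pdle k.+1 X -> pdle k X.
Proof.
move=> ke tX h N; have [n [p ps]] := free_cover N.
have [L [i s]] := ker_ses Rfin ps.
apply: (ext_les_right iotaC Rfin s) (h L); apply: ext_pow.
apply: (ext_retract (iso_retract C0)); apply: ext_domge tX _.
exact: domge_coresolution.
Qed.

(** A projective [X] embeds in a free module and thus in a power of [Q 0], while torsion kills each
    component of this embedding. *)
Lemma tors_projective X : tors X -> projective X -> trivial_mod X.
Proof.
move=> tX pX x; have [n [p ps]] := free_cover X.
have [s sE] := projectiveP idfun pX ps.
have := sE x; rewrite /= => <-.
rewrite (_ : s x = 0) ?linear0 //; apply/ffunP => i; rewrite ffunE.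
have [f fb] := C0; have [ci _ _] := cq 0.
apply: (inj0 (bij_inj fb)); apply: (inj0 ci).
exact: (tX _ (pQ _) (c 0 \o f \o proji i \o s)).
Qed.

Lemma pdle_torsionless M : pdle e.+1 M -> torsionless M.
Proof.
move=> pM; have [X [Z [i [p [s tX [Q' [j [pQ' ji]]]]]]]] := torsion_ses M.
(* The bound passes to the submodule [X] because Ext^{e+3}(Z, -) vanishes by the global
   dimension. *)
have pX : pdle e.+1 X.
  by move=> N; apply: (ext_les_left iotaC Rfin s); [exact: pM|exact: gldimR].
have {}pX : pdle 0 X.
  have : forall k, (k <= e.+1)%N -> pdle (e.+1 - k) X; last first.
    by move=> /(_ e.+1 (leqnn _)); rewrite subnn.
  elim=> [|k IH] ke; first by rewrite subn0.
  have := IH (ltnW ke); rewrite subSn // => h.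
  by rewrite subSS; apply: tors_pdle => //; exact: leq_subr.
have tX0 := tors_projective tX (iffLR (pdle0 iotaC Rfin X) pX).
exists Q', (j \o p); split => //; apply: lin_inj => x /= /(inj0 ji) px.
by have [_ _ /(_ x)[/(_ px)[y <-] _]] := s; rewrite (tX0 y) linear0.
Qed.

Lemma torsionless_pdle M : torsionless M -> pdle e.+1 M.
Proof.
move=> [Q' [j [[pP _] ji]]]; have [Z [p s]] := coker_ses ji.
by apply/(pdle_syz iotaC Rfin _ s pP) => N; exact: gldimR.
Qed.

Lemma cotorsionless_idle M : cotorsionless M -> idle e.+1 M.
Proof.
move=> [Q' [p [[_ iI] ps]]]; have [X [i s]] := ker_ses Rfin ps.
by apply/(idle_cosyz iotaC Rfin _ s iI) => N; exact: gldimR.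
Qed.

(** A right approximation: sum a spanning family of Hom(U, V). The coefficients of [f] define the
    factorization through the power of [U]. *)
Lemma hom_approx U V : exists n (p : {linear fpow n U -> V}),
  forall f : {linear U -> V}, exists g : {linear U -> fpow n U}, forall x, p (g x) = f x.
Proof.
have [m [h hP]] := hom_fin iotaC Rfin U V.
exists m, (fsummap h) => f; have [k kE] := hP f.
have sl j : linear (fun x : U => iota (k j) *: x).
  by move=> b x y; rewrite scalerDr !scalerA iotaC.
exists (fmap (fun j => lin (sl j))) => x; rewrite kE /=.
by apply: eq_bigr => j _; rewrite ffunE linearZ.
Qed.

Lemma approx n V : (n <= e.+2)%N -> exists P (p : {linear P -> V}), pinj P /\
  forall j, (j < n)%N -> forall f : {linear Q j -> V},
  exists g : {linear Q j -> P}, forall x, p (g x) = f x.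
Proof.
elim: n => [|n IH] ne; first by exists fzero, \0%R; split => //; exact: pinj_fzero.
have [P [p [pP h]]] := IH (ltnW ne); have [m [p' h']] := hom_approx (Q n) V.
exists (fprod P (fpow m (Q n))), (copairmap p p'); split.
  by apply: pinj_prod => //; apply: pinj_pow; exact: pQ.
move=> j; rewrite ltnS leq_eqVlt => /orP[/eqP ->|jn] f.
  have [g gE] := h' f; exists (pairmap \0%R g) => x /=.
  by rewrite linear0 add0r gE.
have [g gE] := h j jn f; exists (pairmap g \0%R) => x /=.
by rewrite linear0 addr0 gE.
Qed.

(* This transfers the coresolution of the regular module by projective-injective
   modules to a resolution of injective modules: the hypothesis on V passes to
   the kernel of a right approximation by the modules Q j, at the cost of one
   step, and at j = 0 it makes that approximation surjective. *)
Lemma codge_of_ext n V : (n <= e.+2)%N ->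
  (forall j, (j < n)%N -> forall f : {linear C j -> V},
    exists g : {linear Q j -> V}, forall x, g (c j x) = f x) ->
  codge n V.
Proof.
elim: n V => // n IH V ne h; have [P [p [pP ap]]] := approx V ne.
have ps x : exists y, p y = x.
  (* The map from the regular module sending 1 to [x] extends from [C 0] to [Q 0] by hypothesis and
     then factors through [p]. *)
  have [phi phib] := C0; have /iso_sym[psi psib] := C0.
  have [g gE] := h 0%N isT (scalemap x \o psi).
  have [t tE] := ap 0%N isT g.
  have [z zE] : exists z, psi z = 1 by case: psib => w _ /(_ 1) <-; exists (w 1).
  by exists (t (c 0%N z)); rewrite tE gE /= zE scale1r.
have [X [i s]] := ker_ses Rfin ps; exists X, P, i, p; split => //.
have [ii _ pk] := s.
apply: IH => [|j jn f]; first exact: ltnW.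
have [ci qs qk] := cq j.
(* Extend [i \o f] to [u : Q j -> P]. Its composite with [p] factors through [C j.+1], extends to
   [Q j.+1] and lifts to [t]; subtracting this correction from [u] makes it land in [X] without
   changing it on [C j]. *)
have [u uE] := injectiveP (i \o f) pP.2 ci.
have [|v vE] := @factor_surj _ _ _ _ (q j) (p \o u) qs.
  by move=> _ /qk[x <-] /=; rewrite uE /= (ses_comp _ s).
have [w wE] := h j.+1 jn v; have [t tE] := ap j.+1 jn w.
have [|g gE] := @factor_inj _ _ _ _ i (u \- (t \o c j.+1 \o q j)) ii.
  by move=> x; apply/pk; rewrite /= linearB /= tE wE vE subrr.
exists g => x; apply: ii; rewrite gE /= uE /= (ses_comp _ (cq j)).
by rewrite !linear0 addr0.
Qed.

Lemma codge_injective I : injective_mod I -> codge e.+2 I.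
Proof.
move=> iI; apply: codge_of_ext => // j _ f; have [ci _ _] := cq j.
exact: injectiveP f iI ci.
Qed.

(** Embed [M] in an injective [J] with cokernel [L]: Ext^{k+1}(M, Y) lies between Ext^{k+1}(J, Y),
    zero by the resolution of [J], and Ext^{k+2}(L, Y). *)
Lemma cotors_idle k Y : (k <= e)%N -> cotors Y -> idle k.+1 Y -> idle k Y.
Proof.
move=> ke tY h M; have [J [L [j [p [s iJ]]]]] := cosyz_exists iotaC Rfin M.
apply: (ext_les_left iotaC Rfin s) (h L); apply: ext_codge tY _.
have := codge_injective iJ.
suff : forall m n V, (n <= m)%N -> codge m V -> codge n V by apply; rewrite !ltnS.
elim=> [|m IH] [|n] V // nm [X [P [i [p' [s' pP hX]]]]].
by exists X, P, i, p'; split => //; exact: IH.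
Qed.

(** The cotorsion quotient [Y] becomes injective by descent, hence a quotient of a
    projective-injective module; all maps from such modules to [Y] vanish, so [Y] is zero. *)
Lemma idle_cotorsionless M : idle e.+1 M -> cotorsionless M.
Proof.
move=> iM; have [X [Y [i [p [s [P [r [pP rs]]] tY]]]]] := cotorsion_ses M.
have iY : idle e.+1 Y.
  by move=> N; apply: (ext_les_right iotaC Rfin s); [exact: iM|exact: gldimR].
have {}iY : idle 0 Y.
  have : forall k, (k <= e.+1)%N -> idle (e.+1 - k) Y; last first.
    by move=> /(_ e.+1 (leqnn _)); rewrite subnn.
  elim=> [|k IH] ke; first by rewrite subn0.
  have := IH (ltnW ke); rewrite subSn // => h.
  by rewrite subSS; apply: cotors_idle => //; exact: leq_subr.
have := codge_injective (iffLR (idle0 iotaC Rfin Y) iY).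
move=> [_ [P' [_ [p' [[_ ps' _] pP' _]]]]].
exists P, (i \o r); split => // y; have [_ _ pk] := s.
have /pk[x <-] : p y = 0 by have [z <-] := ps' (p y); exact: tY.
by have [z <-] := rs x; exists z.
Qed.

End Coresolution.
End Torsion.

(** * Krull-Schmidt *)

Section Splitting.
Variable R : nzRingType.
Implicit Types M N X Y Z P H : lmodType R.

Lemma retract_summand X M : retract X M -> exists Y, isomorphic M (X * Y)%type.
Proof.
move=> [s [r rs]]; have [Y [i [ii ik]]] := ker_exists r.
exists Y; apply: iso_sym; exists (copairmap s i); apply: lin_bij.
  apply: lin_inj => -[x y] /= e; have ri : r (i y) = 0 by apply/ik; exists y.
  have x0 : x = 0 by have /(congr1 r) := e; rewrite linearD /= rs ri addr0 linear0.
  apply/pair_equal_spec; split => //; apply: (inj0 ii).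
  by move: e; rewrite x0 linear0 add0r.
move=> m; have /ik[y yE] : r (m - s (r m)) = 0 by rewrite linearB /= rs subrr.
by exists (r m, y); rewrite /= yE addrC subrK.
Qed.

Lemma retract_indecomposable X M : indecomposable M -> retract X M ->
  trivial_mod X \/ isomorphic M X.
Proof.
move=> [_ h] rX; have [Y iY] := retract_summand rX.
case: (h _ _ iY) => [|tY]; [by left|right].
apply: iso_trans iY _; exists fst; apply: lin_bij; last by move=> x; exists (x, 0).
by apply: lin_inj => -[x y] /= ->; rewrite (tY y).
Qed.

Lemma retract_trivial X M : retract X M -> trivial_mod M -> trivial_mod X.
Proof. by move=> [s [r rs]] tM x; rewrite -(rs x) (tM (s x)) linear0. Qed.

Definition prodmap M N X Y (f : {linear M -> X}) (g : {linear N -> Y}) :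
  {linear (M * N)%type -> (X * Y)%type} := pairmap (f \o fst) (g \o snd).

Lemma ses_prod X Y Z X' Y' Z' (i : {linear X -> Y}) (p : {linear Y -> Z})
    (i' : {linear X' -> Y'}) (p' : {linear Y' -> Z'}) :
  ses i p -> ses i' p' -> ses (prodmap i i') (prodmap p p').
Proof.
move=> [ii ps pk] [ii' ps' pk']; split.
- by move=> [x x'] [y y'] /= [/ii -> /ii' ->].
- by move=> [z z']; have [y <-] := ps z; have [y' <-] := ps' z'; exists (y, y').
- move=> [y y'] /=; split => [[/pk[x <-] /pk'[x' <-]]|]; first by exists (x, x').
  move=> [[x x'] /= [e e']]; apply/pair_equal_spec; split.
    by apply/pk; exists x.
  by apply/pk'; exists x'.
Qed.

End Splitting.

Section KrullSchmidt.
Variables (K : fieldType) (R : nzRingType) (iota : {rmorphism K -> R}).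
Hypothesis iotaC : forall k r, iota k * r = r * iota k.
Hypothesis Rfin : exists n (b : 'I_n -> R), forall r, exists c : 'I_n -> K,
  r = \sum_i iota (c i) * b i.
Implicit Types M N X Y Z P Q I J L W C U V G H : fmod R.

Fixpoint lpow (M : lmodType R) (h : {linear M -> M}) n : {linear M -> M} :=
  if n is n'.+1 then h \o lpow h n' else idfun.

Lemma lpowD (M : lmodType R) (h : {linear M -> M}) m n x :
  lpow h (m + n) x = lpow h m (lpow h n x).
Proof. by elim: m => //= m ->. Qed.

(** Among the images of positive powers of [h] take one of least dimension. The same power of [h] is
    then bijective on it, so it splits off. *)
Lemma stable_image M (h : {linear M -> M}) :
  exists n Z (q : {linear M -> Z}) (j : {linear Z -> M}),
    [/\ forall z, exists x, q x = z, injective j,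
        forall x, j (q x) = lpow h n.+1 x & retract Z M].
Proof.
pose D Z := exists n (q : {linear M -> Z}) (j : {linear Z -> M}),
  [/\ forall z, exists x, q x = z, injective j & forall x, j (q x) = lpow h n.+1 x].
have [|Z [[n [q [j [qs ji jq]]]] Zmin]] := @kdim_min _ _ _ Rfin D.
  have [Z [q [j hZ]]] := im_fmod (lpow h 1).
  by exists Z, 0%N, q, j.
have [Z' [q' [j' [qs' ji' jq']]]] := im_fmod (q \o j).
have qi' : injective q'.
  apply: (kdim_surj_eq (Rfin := Rfin) qs'); apply: Zmin.
  (* The composite is h^(2n+2), and [D] records the exponent minus one. *)
  exists (n.+1 + n)%N, (q' \o q), (j \o j'); split => [z|x y /ji/ji'//|x].
    by have [y <-] := qs' z; have [x <-] := qs y; exists x.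
  by rewrite /= jq' /= jq jq -lpowD addnS.
have ti : injective (q \o j) by move=> x y /= e; apply: qi'; apply: ji'; rewrite !jq'.
have ts := kdim_inj_eq (Rfin := Rfin) ti (leqnn _).
have [t tE] : exists t : {linear Z -> Z}, forall x, t (q (j x)) = x.
  by have [|t tE] := @factor_surj _ _ _ _ (q \o j) idfun ts;
    [move=> w; exact: inj0|exists t].
by exists n, Z, q, j; split => //; exists j, (t \o q).
Qed.

(** The stable image is a summand of an indecomposable module, so it is zero, and [h] is nilpotent,
    or isomorphic to [M], and [h] is bijective. *)
Lemma fitting M (h : {linear M -> M}) : indecomposable M ->
  bijective h \/ exists n, forall x, lpow h n x = 0.
Proof.
move=> iM; have [n [Z [q [j [qs ji jq rZ]]]]] := stable_image h.
case: (retract_indecomposable iM rZ) => [tZ|[f fb]].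
  by right; exists n.+1 => x; rewrite -jq (tZ (q x)) linear0.
left; have qi : injective q.
  by apply: (kdim_surj_eq (Rfin := Rfin) qs); exact: kdim_inj (bij_inj fb).
have hi : injective h.
  apply: lin_inj => x hx0; apply: (inj0 qi); apply: (inj0 ji).
  by rewrite jq -addn1 lpowD /= hx0 linear0.
exact: lin_bij hi (kdim_inj_eq (Rfin := Rfin) hi (leqnn _)).
Qed.

(** The identity of [M] is a sum a + b of endomorphisms through [N] and [N']. By Fitting, a is
    bijective or nilpotent; if a is nilpotent, b x = 0 gives a x = x and so x = 0, whence b is
    bijective. *)
Lemma retract_prodP M (N N' : lmodType R) : indecomposable M ->
  retract M (N * N')%type -> retract M N \/ retract M N'.
Proof.
move=> iM [s [r rs]].
have retr (L : lmodType R) (u : {linear M -> L}) (v : {linear L -> M}) :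
    bijective (v \o u) -> retract M L.
  move=> vub; have vuI : isomorphic M M by exists (v \o u).
  have [||g gE] := @factor_surj _ _ _ _ (v \o u) idfun.
  - by move=> y; case: vub => w _ /(_ y); exists (w y).
  - by move=> w; apply: inj0; exact: bij_inj.
  - by exists u, (g \o v).
have ab x : r (linl N N' (s x).1) + r (linr N N' (s x).2) = x.
  rewrite -linearD /= (_ : _ + _ = s x) //; case: (s x) => a b.
  by apply/pair_equal_spec; split; rewrite /= ?addr0 ?add0r.
have [aB|[n an]] := fitting ((r \o linl N N') \o (fst \o s)) iM.
  by left; exact: retr aB.
right; apply: (retr _ (snd \o s) (r \o linr N N')).
have bi : injective ((r \o linr N N') \o (snd \o s)).
  apply: lin_inj => x /= bx; have := ab x; rewrite bx addr0 => ax.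
  rewrite -(an x); elim: n {an} => //= n <-.
  by rewrite ax.
exact: lin_bij bi (kdim_inj_eq (Rfin := Rfin) bi (leqnn _)).
Qed.

Lemma retract_powP M (N : lmodType R) n : indecomposable M ->
  retract M {ffun 'I_n -> N} -> retract M N.
Proof.
move=> iM; elim: n => [|n IH] h.
  case: iM => /(_ _)[]; apply: retract_trivial h _ => x.
  by apply/ffunP => -[].
have := retract_trans h (retract_ffunS n N).
by case/(retract_prodP iM).
Qed.

(** Induction on the dimension over K; the retract clause serves to pass from a product
    decomposition back to [M]. *)
Lemma decomposition_ind (D : fmod R -> Prop) :
  (forall M, trivial_mod M -> D M) -> (forall M, indecomposable M -> D M) ->
  (forall M N, D M -> D N -> D (fprod M N)) ->
  (forall M N, retract M N -> D N -> D M) -> forall M, D M.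
Proof.
move=> D0 Di Dp Dr M; have [n] := ubnP (kdim Rfin M).
elim: n M => // n IH M; rewrite ltnS => Mn.
have [|tM] := pselect (trivial_mod M); first exact: D0.
have [|nM] := pselect (indecomposable M); first exact: Di.
have [X [Y [iM [tX tY]]]] : exists X Y : lmodType R,
    isomorphic M (X * Y)%type /\ ~ trivial_mod X /\ ~ trivial_mod Y.
  apply: contrapT => h; apply: nM; split => // X Y iM.
  have [|tX] := pselect (trivial_mod X); [by left|right].
  by apply: contrapT => tY; apply: h; exists X, Y.
(* The two factors come as bare modules; this supplies their finite generation and the drop in
   dimension. *)
have small (A B : lmodType R) : isomorphic M (A * B)%type -> ~ trivial_mod B ->
    exists A' : fmod R, (A' = A :> lmodType R) /\ (kdim Rfin A' < n)%N.
  move=> /iso_sym[f fb] tB.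
  have gi : injective (f \o linl A B) by move=> x y /= /(bij_inj fb)[].
  exists (Fmod (fg_sub Rfin gi (fmP M))); split => //.
  apply: leq_trans Mn; rewrite ltnNge; apply/negP => le.
  apply: tB => b.
  have := @kdim_inj_eq _ _ _ Rfin (Fmod (fg_sub Rfin gi (fmP M))) M _ gi le.
  by move=> /(_ (f (0, b)))[x /= /(bij_inj fb)[_ <-]].
have [X' [eX nX]] := small X Y iM tY.
have iM' : isomorphic M (Y * X)%type.
  apply: iso_trans iM _; exists (pairmap snd fst).
  by exists (fun p => (p.2, p.1)) => -[].
have [Y' [eY nY]] := small Y X iM' tX.
subst X Y; apply: (Dr M (fprod X' Y') (iso_retract iM)).
by apply: Dp; exact: IH.
Qed.

Lemma finite_retracts G : exists n (F : 'I_n -> lmodType R),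
  forall M, indecomposable M -> retract M G -> exists i, isomorphic M (F i).
Proof.
move: G; apply: decomposition_ind.
- move=> G tG; exists 0%N, (fun=> G) => M [nM _] rM.
  by case: nM; exact: retract_trivial rM tG.
- move=> G iG; exists 1%N, (fun=> G) => M [nM _] rM; exists ord0.
  by case: (retract_indecomposable iG rM) => // /iso_sym.
- move=> G H [m [F FP]] [n [E EP]].
  exists (m + n)%N, (fun i => match split i with inl i => F i | inr j => E j end).
  move=> M iM; case/(retract_prodP iM) => [/(FP _ iM)|/(EP _ iM)] [i Mi].
    by exists (lshift n i); rewrite (unsplitK (inl i) : split (lshift n i) = inl i).
  by exists (rshift m i); rewrite (unsplitK (inr i) : split (rshift m i) = inr i).
- move=> G H GH [n [F FP]]; exists n, F => M iM MG; apply: FP => //.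
  exact: retract_trans MG GH.
Qed.

(** Finite type is traded for a single module having all the indecomposables in question as
    summands, a form stable under syzygies; Krull-Schmidt gives the way back. *)
Lemma finite_typeP (D : lmodType R -> Prop) :
  finite_type D <->
  exists G, forall M, indecomposable M -> D M -> retract M G.
Proof.
split => [[n [F FP]]|[G GP]]; last first.
  have [n [F FP]] := finite_retracts G.
  by exists n, F => M fM iM DM; apply: (FP (Fmod fM)) => //; exact: GP.
suff [G GP] : exists G, forall i, fg (F i) -> retract (F i) G.
  exists G => M iM DM; have [i Mi] := FP M (fmP M) iM DM.
  apply: retract_trans (iso_retract Mi) (GP i _).
  have [f [g fK gK]] := Mi; apply: (fg_quo (f := f)) (fmP M) => y.
  by exists (g y).
(* The listed modules need not be finitely generated; those that are not are left out of [G]. *)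
elim: n F {FP} => [|n IH] F; first by exists (fzero R) => -[].
have [G GP] := IH (fun i => F (lift ord0 i)).
have [f0|nf0] := pselect (fg (F ord0)).
  exists (fprod (Fmod f0) G) => i; case: (unliftP ord0 i) => [j|] -> h.
    exact: retract_trans (GP j h) (retract_prodr _ _).
  exact: (retract_prodl (Fmod f0) G).
by exists G => i; case: (unliftP ord0 i) => [j|] -> //; exact: GP.
Qed.

(** Schanuel's argument for a summand [C] of [H]: with comparison maps [u : Q -> P] and
    [v : P -> Q], the difference of the identity and v u maps [Q] into [M], so the identity of [M]
    factors through [X] and [Q]. *)
Lemma retract_syz M Q C X P H (i : {linear M -> Q}) (p : {linear Q -> C})
    (k : {linear X -> P}) (h : {linear P -> H}) :
  ses i p -> projective Q -> ses k h -> projective P -> retract C H ->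
  retract M (fprod X Q).
Proof.
move=> sM pQ sH pP [s [r rs]]; have [ii ps pk] := sM; have [ki hs hk] := sH.
have [u uE] := projectiveP (s \o p) pQ hs.
have [v vE] := projectiveP (r \o h) pP ps.
have [|u' uE'] := @factor_inj _ _ _ _ k (u \o i) ki.
  by move=> x; apply/hk; rewrite /= uE /= (ses_comp _ sM) linear0.
have [|v' vE'] := @factor_inj _ _ _ _ i (v \o k) ii.
  by move=> x; apply/pk; rewrite /= vE /= (ses_comp _ sH) linear0.
have [|w wE] := @factor_inj _ _ _ _ i (idfun \- (v \o u)) ii.
  by move=> x; apply/pk; rewrite /= linearB /= vE /= uE /= rs subrr.
exists (pairmap u' i), (copairmap v' w) => x; apply: ii.
by rewrite /= linearD vE' /= uE' wE /= addrC subrK.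
Qed.

Lemma retract_cosyz M Q C L I H (i : {linear C -> Q}) (p : {linear Q -> M})
    (k : {linear H -> I}) (h : {linear I -> L}) :
  ses i p -> injective_mod Q -> ses k h -> injective_mod I -> retract C H ->
  retract M (fprod L Q).
Proof.
move=> sM iQ sH iI [s [r rs]]; have [ii ps pk] := sM; have [ki hs hk] := sH.
have [u uE] := injectiveP (k \o s) iI ii.
have [v vE] := injectiveP (i \o r) iQ ki.
have [|u' uE'] := @factor_surj _ _ _ _ p (h \o u) ps.
  by move=> _ /pk[x <-]; rewrite /= uE /= (ses_comp _ sH).
have [|v' vE'] := @factor_surj _ _ _ _ h (p \o v) hs.
  by move=> _ /hk[x <-]; rewrite /= vE /= (ses_comp _ sM).
have [|w wE] := @factor_surj _ _ _ _ p (idfun \- (v \o u)) ps.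
  by move=> _ /pk[x <-]; rewrite /= uE /= vE /= rs subrr.
exists (pairmap u' w), (copairmap v' p) => x; have [y <-] := ps x.
by rewrite /= uE' vE' wE /= linearB /= addrC subrK.
Qed.

Lemma ext_retract_left n M M' N : retract M M' -> ext n M' N -> ext n M N.
Proof.
move=> [s [r rs]]; elim: n N => [|n IH] N h;
  have [J [L [j [q [sN iJ]]]]] := cosyz_exists iotaC Rfin N.
  apply: (ext1_of_inj sN iJ) => f.
  have [g gE] := ext1_inj Rfin h sN (f \o r).
  by exists (g \o s) => x /=; rewrite gE /= rs.
exact/(ext_cosyz iotaC Rfin n M sN iJ)/IH/(ext_cosyz iotaC Rfin n M' sN iJ).
Qed.

Lemma pdle_retract n M M' : retract M M' -> pdle n M' -> pdle n M.
Proof. by move=> r h N; exact: ext_retract_left r (h N). Qed.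

Lemma idle_retract n M M' : retract M M' -> idle n M' -> idle n M.
Proof. by move=> r h N; exact: ext_retract r (h N). Qed.

(** * Propagation of finiteness from the top dimension to all modules *)

Section Propagation.
Variable d : nat.

(** Descend from the modules with [~ pdle d] to those with [~ pdle 0]; the remaining indecomposables
    are projective, hence summands of the regular module. *)
Lemma finite_type_of_pd :
  (forall M, pdle d M -> torsionless M) ->
  (exists G, forall M, indecomposable M -> ~ pdle d M -> retract M G) ->
  exists G, forall M, indecomposable M -> retract M G.
Proof.
move=> dT dG.
(* The new modules have [pdle k.+1] but not [pdle k]. Such an [M] embeds in a projective-injective
   [Q], and the cokernel [C] is compared with [G]. *)
have step k : (k < d)%N ->
    (exists G, forall M, indecomposable M -> ~ pdle k.+1 M -> retract M G) ->
    exists G, forall M, indecomposable M -> ~ pdle k M -> retract M G.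
  move=> kd [G GP]; have [X0 [P0 [i0 [p0 [s0 pP0]]]]] := syz_exists Rfin G.
  exists (fprod X0 G) => M iM nM.
  have [pM|] := pselect (pdle k.+1 M); last first.
    by move/(GP M iM) => h; apply: retract_trans h (retract_prodr _ _).
  have [Q [j [[pQ _] ji]]] := dT M (pdle_leq iotaC Rfin kd pM).
  have [C [q s]] := coker_ses ji.
  (* [H] is assembled from the indecomposable pieces of [C]: a piece with [pdle k.+1] keeps a syzygy
     of its own, which has [pdle k]; any other piece is a summand of [G] and is replaced by [G],
     with syzygy [X0]. *)
  have [X [P [H [i [p [sH pP rC hX]]]]]] : exists X P H (i : {linear X -> P})
      (p : {linear P -> H}), [/\ ses i p, projective P, retract C H &
      forall N, indecomposable N -> retract N X -> retract N X0 \/ pdle k N].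
    have small C' : pdle k.+1 C' -> exists X P H (i : {linear X -> P})
      (p : {linear P -> H}), [/\ ses i p, projective P, retract C' H &
      forall N, indecomposable N -> retract N X -> retract N X0 \/ pdle k N].
      move=> hC; have [X [P [i [p [sC pP]]]]] := syz_exists Rfin C'.
      exists X, P, C', i, p; split => //; first exact: retract_refl.
      move=> N _ rN; right; apply: pdle_retract rN _.
      exact/(pdle_syz iotaC Rfin k sC pP).
    move: C {q s}; apply: decomposition_ind.
    - move=> C tC; apply: small; apply: (pdle_leq iotaC Rfin (leq0n _)).
      exact/(pdle0 iotaC Rfin)/trivial_projective.
    - move=> C iC; have [|nC] := pselect (pdle k.+1 C); first exact: small.
      by exists X0, P0, G, i0, p0; split => //; [exact: GP|left].
    - move=> C C' [X [P [H [i [p [sH pP rC hX]]]]]].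
      move=> [X' [P' [H' [i' [p' [sH' pP' rC' hX']]]]]].
      exists (fprod X X'), (fprod P P'), (fprod H H'), (prodmap i i'), (prodmap p p').
      split; [exact: ses_prod|exact: projective_prod|exact: retract_prod|].
      by move=> N iN /(retract_prodP iN)[/(hX _ iN)|/(hX' _ iN)].
    - move=> C C' CC [X [P [H [i [p [sH pP rC hX]]]]]].
      by exists X, P, H, i, p; split => //; exact: retract_trans CC rC.
  (* As [M] fails [pdle k], it is neither a summand of [Q] nor of the second kind, so it is a
     summand of [X0]. *)
  have := retract_syz s pQ sH pP rC; case/(retract_prodP iM).
    move=> /(hX _ iM)[h|/nM//].
    exact: retract_trans h (retract_prodl _ _).
  move=> /projective_retract/(_ pQ) pM'; case: nM => N; exact: (ext_projective iotaC Rfin).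
have [G GP] : exists G, forall M, indecomposable M -> ~ pdle 0 M -> retract M G.
  have : forall k, (k <= d)%N ->
      exists G, forall M, indecomposable M -> ~ pdle (d - k) M -> retract M G.
    elim=> [|k IH] kd; first by rewrite subn0.
    have := IH (ltnW kd); rewrite -(subnSK kd); apply: step.
    by rewrite ltn_subrL; case: (d) kd.
  by move=> /(_ d (leqnn d)); rewrite subnn.
exists (fprod G (freg R)) => M iM.
have [/(pdle0 iotaC Rfin) pM|h] := pselect (pdle 0 M); last first.
  exact: retract_trans (GP M iM h) (retract_prodl _ _).
have [n [p ps]] := free_cover M; have [s sE] := projectiveP idfun pM ps.
have /(retract_powP iM) h : retract M (fpow n (freg R)) by exists s, p.
exact: retract_trans h (retract_prodr _ _).
Qed.

(** The dual descent along cosyzygies, ending with the injectives, which are summands of powers of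
    D(R). *)
Lemma finite_type_of_id :
  (forall M, idle d M -> cotorsionless M) ->
  (exists G, forall M, indecomposable M -> ~ idle d M -> retract M G) ->
  exists G, forall M, indecomposable M -> retract M G.
Proof.
move=> dT dG.
have step k : (k < d)%N ->
    (exists G, forall M, indecomposable M -> ~ idle k.+1 M -> retract M G) ->
    exists G, forall M, indecomposable M -> ~ idle k M -> retract M G.
  move=> kd [G GP]; have [I0 [L0 [i0 [p0 [s0 iI0]]]]] := cosyz_exists iotaC Rfin G.
  exists (fprod L0 G) => M iM nM.
  have [pM|] := pselect (idle k.+1 M); last first.
    by move/(GP M iM) => h; apply: retract_trans h (retract_prodr _ _).
  have [Q [q [[_ iQ] qs]]] := dT M (idle_leq iotaC Rfin kd pM).
  have [C [j s]] := ker_ses Rfin qs.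
  have [H [I [L [i [p [sH iI rC hL]]]]]] : exists H I L (i : {linear H -> I})
      (p : {linear I -> L}), [/\ ses i p, injective_mod I, retract C H &
      forall N, indecomposable N -> retract N L -> retract N L0 \/ idle k N].
    have small C' : idle k.+1 C' -> exists H I L (i : {linear H -> I})
      (p : {linear I -> L}), [/\ ses i p, injective_mod I, retract C' H &
      forall N, indecomposable N -> retract N L -> retract N L0 \/ idle k N].
      move=> hC; have [I [L [i [p [sC iI]]]]] := cosyz_exists iotaC Rfin C'.
      exists C', I, L, i, p; split => //; first exact: retract_refl.
      move=> N _ rN; right; apply: idle_retract rN _.
      exact/(idle_cosyz iotaC Rfin k sC iI).
    move: C {j s}; apply: decomposition_ind.
    - move=> C tC; apply: small; apply: (idle_leq iotaC Rfin (leq0n _)).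
      exact/(idle0 iotaC Rfin)/trivial_injective.
    - move=> C iC; have [|nC] := pselect (idle k.+1 C); first exact: small.
      by exists G, I0, L0, i0, p0; split => //; [exact: GP|left].
    - move=> C C' [H [I [L [i [p [sH iI rC hL]]]]]].
      move=> [H' [I' [L' [i' [p' [sH' iI' rC' hL']]]]]].
      exists (fprod H H'), (fprod I I'), (fprod L L'), (prodmap i i'), (prodmap p p').
      split; [exact: ses_prod|exact: injective_prod|exact: retract_prod|].
      by move=> N iN /(retract_prodP iN)[/(hL _ iN)|/(hL' _ iN)].
    - move=> C C' CC [H [I [L [i [p [sH iI rC hL]]]]]].
      by exists H, I, L, i, p; split => //; exact: retract_trans CC rC.
  have := retract_cosyz s iQ sH iI rC; case/(retract_prodP iM).
    move=> /(hL _ iM)[h|/nM//].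
    exact: retract_trans h (retract_prodl _ _).
  move=> /injective_retract/(_ iQ) pM'; case: nM => N; exact: (ext_injective Rfin).
have [G GP] : exists G, forall M, indecomposable M -> ~ idle 0 M -> retract M G.
  have : forall k, (k <= d)%N ->
      exists G, forall M, indecomposable M -> ~ idle (d - k) M -> retract M G.
    elim=> [|k IH] kd; first by rewrite subn0.
    have := IH (ltnW kd); rewrite -(subnSK kd); apply: step.
    by rewrite ltn_subrL; case: (d) kd.
  by move=> /(_ d (leqnn d)); rewrite subnn.
exists (fprod G (frdual iotaC Rfin)) => M iM.
have [/(idle0 iotaC Rfin) iM'|h] := pselect (idle 0 M); last first.
  exact: retract_trans (GP M iM h) (retract_prodl _ _).
have [n [j ji]] := cofree_hull iotaC Rfin M; have [r rE] := injectiveP idfun iM' ji.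
have /(retract_powP iM) h : retract M (fpow n (frdual iotaC Rfin)) by exists j, r.
exact: retract_trans h (retract_prodr _ _).
Qed.

End Propagation.
End KrullSchmidt.

(** * Minimal resolutions *)

Section Minimal.
Variables (K : fieldType) (R : nzRingType) (iota : {rmorphism K -> R}).
Hypothesis iotaC : forall k r, iota k * r = r * iota k.
Hypothesis Rfin : exists n (b : 'I_n -> R), forall r, exists c : 'I_n -> K,
  r = \sum_i iota (c i) * b i.
Implicit Types M N X Y Z P Q I J L W C U V G H : fmod R.

Record cover M := Cover {
  cover_syz : fmod R; cover_obj : fmod R;
  cover_i : {linear cover_syz -> cover_obj};
  cover_p : {linear cover_obj -> M};
  cover_ses : ses cover_i cover_p;
  cover_proj : projective cover_obj;
  cover_min : superfluous (ker cover_p)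
}.

Record hull M := Hull {
  hull_obj : fmod R; hull_cosyz : fmod R;
  hull_i : {linear M -> hull_obj};
  hull_p : {linear hull_obj -> hull_cosyz};
  hull_ses : ses hull_i hull_p;
  hull_inj : injective_mod hull_obj;
  hull_min : essential (range hull_i)
}.

(* A cover of least dimension is minimal: an endomorphism h of P over M has a
   stable image, which is a direct summand of P still covering M. *)
Lemma cover_exists M : exists c : cover M, True.
Proof.
pose D P := projective P /\ exists p : {linear P -> M}, forall y, exists x, p x = y.
have [|P [[pP [p ps]] Pmin]] := @kdim_min _ _ _ Rfin D.
  have [X [P [i [p [[_ ps _] pP]]]]] := syz_exists Rfin M.
  by exists P; split => //; exists p.
have [X [i s]] := ker_ses Rfin ps.
suff m : superfluous (ker p) by exists (Cover s pP m).
move=> T sT TE; have [T' [j [ji jT]]] := sub_exists sT.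
pose F := Fmod (fg_sub Rfin ji (fmP P)).
have pjs y : exists x : F, (p \o j) x = y.
  have [x <-] := ps y; have [u [t [ku /jT[w wE] ->]]] := TE x.
  by exists w; rewrite /= wE linearD ku add0r.
have [h hE] := projectiveP (M := F) p pP pjs.
have pE n x : p (lpow (j \o h) n x) = p x.
  by elim: n => //= n <-; rewrite -[RHS]hE.
have [n [Z [q [k [qs ki kq rZ]]]]] := stable_image Rfin (j \o h).
have Pk : (kdim Rfin P <= kdim Rfin Z)%N.
  apply: Pmin; split; first exact: projective_retract rZ pP.
  exists (p \o k) => y; have [x <-] := ps y; exists (q x).
  by rewrite /= kq pE.
apply/seteqP; split => // x _; apply/jT.
have [z <-] := kdim_inj_eq (Rfin := Rfin) ki Pk x.
by have [y <-] := qs z; rewrite kq /=; eexists.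
Qed.

(** Take [I] of least dimension. If [T] meets [M] trivially, [M] embeds in I/T and its inclusion
    extends to [h] on I/T; the stable image of [h \o j] is a summand that still receives an
    embedding of [M], so [h \o j] is injective and [T] is zero. *)
Lemma hull_exists M : exists c : hull M, True.
Proof.
pose D I := injective_mod I /\ exists i : {linear M -> I}, injective i.
have [|I [[iI [i ii]] Imin]] := @kdim_min _ _ _ Rfin D.
  have [I [X [i [p [[ii _ _] iI]]]]] := cosyz_exists iotaC Rfin M.
  by exists I; split => //; exists i.
have [X [p s]] := coker_ses ii.
suff m : essential (range i) by exists (Hull s iI m).
move=> T sT TE; have [T' [j [js jT]]] := quo_exists sT.
pose F := Fmod (fg_quo js (fmP I)).
have pji : injective (j \o i : {linear M -> F}).
  apply: lin_inj => x /= /jT Tx; apply: (inj0 ii).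
  suff : (T `&` range i)%classic (i x) by rewrite TE.
  by split => //; exists x.
have [h hE] := injectiveP (N := F) i iI pji.
have pE n x : lpow (h \o j) n (i x) = i x.
  by elim: n => //= n ->; rewrite -[RHS]hE.
have [n [Z [q [k [qs ki kq rZ]]]]] := stable_image Rfin (h \o j : {linear I -> I}).
have Ik : (kdim Rfin I <= kdim Rfin Z)%N.
  apply: Imin; split; first exact: injective_retract rZ iI.
  by exists (q \o i); apply: lin_inj => x /= /(congr1 k); rewrite kq pE linear0 => /(inj0 ii).
have qi := kdim_surj_eq (Rfin := Rfin) qs Ik.
apply/seteqP; split => [x Tx|_ ->]; last exact: submodule0.
have /jT jx := Tx; apply: (inj0 qi); apply: (inj0 ki).
rewrite kq -addn1 lpowD /=; rewrite (_ : h (j x) = 0) ?linear0 //.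
by rewrite jx linear0.
Qed.

Definition cov M : cover M := projT1 (cid (cover_exists M)).
Definition hul M : hull M := projT1 (cid (hull_exists M)).

(** A splitting [t] gives P = ker p + range t, so superfluity forces [t] to be onto. *)
Lemma cover_projective M (c : cover M) : projective M -> trivial_mod (cover_syz c).
Proof.
case: c => X P i p s pP m /= pM; have [ii ps pk] := s.
have [t tE] := projectiveP idfun pM ps.
have tT : range t = setT.
  apply: m; first exact: range_submodule.
  move=> x; exists (x - t (p x)), (t (p x)); split.
  - by rewrite /ker /= linearB /= tE subrr.
  - by exists (p x).
  - by rewrite subrK.
move=> x; apply: (inj0 ii).
have [y _ yE] : range t (i x) by rewrite tT.
have y0 : y = 0 by have := tE y; rewrite yE (ses_comp _ s) /= => <-.
by rewrite -yE y0 linear0.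
Qed.

Lemma hull_injective M (c : hull M) : injective_mod M -> trivial_mod (hull_cosyz c).
Proof.
case: c => I C i p s iI m /= iM; have [ii ps pk] := s.
have [r rE] := injectiveP idfun iM ii.
have k0 : ker r = [set 0]%classic.
  apply: m; first exact: ker_submodule.
  apply/seteqP; split => [z [/= k [x _ xE]]|z ->].
    by move: k; rewrite /ker -xE /= rE /= => ->; rewrite linear0.
  by split; [rewrite /ker /= linear0|exists 0; rewrite ?linear0].
move=> y; have [x <-] := ps y; apply/pk; exists (r x).
have : ker r (x - i (r x)) by rewrite /ker /= linearB /= rE subrr.
by rewrite k0 /= => /eqP; rewrite subr_eq0 => /eqP.
Qed.

Fixpoint syzygy M n : fmod R :=
  if n is n'.+1 then cover_syz (cov (syzygy M n')) else M.
Fixpoint cosyzygy M n : fmod R :=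
  if n is n'.+1 then hull_cosyz (hul (cosyzygy M n')) else M.

Lemma min_proj_resolution M : exists P : proj_resolution M,
  minimal_proj P /\ forall n, pdle n M -> forall m, (n < m)%N -> trivial_mod (P m).
Proof.
pose S := syzygy M; pose c n := cov (S n).
pose d n : {linear cover_obj (c n.+1) -> cover_obj (c n)} :=
  cover_i (c n) \o cover_p (c n.+1).
have kd n : ker (d n) = ker (cover_p (c n.+1)).
  have [ii _ _] := cover_ses (c n); apply/seteqP; split => x; rewrite /ker /=.
    by move/(inj0 ii).
  by move=> ->; rewrite linear0.
have rd n : range (d n) = ker (cover_p (c n)).
  have [_ ps _] := cover_ses (c n.+1); have [_ _ pk] := cover_ses (c n).
  apply/seteqP; split => [_ [x _ <-]|y /pk[x <-]].
    by rewrite /ker /d /= (ses_comp _ (cover_ses (c n))).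
  by have [z <-] := ps x; exists z.
unshelve eexists.
  apply: (@ProjResolution R M (fun n => cover_obj (c n)) (cover_p (c 0%N)) d).
  - by move=> n; exact: fmP.
  - by move=> n; exact: cover_proj.
  - have [_ ps _] := cover_ses (c 0%N); apply/seteqP; split => // y _.
    by have [x <-] := ps y; exists x.
  - exact: rd.
  - by move=> n; rewrite rd kd.
split; first by split => [|n] /=; rewrite ?kd; exact: cover_min.
move=> n pM m nm /=.
have pS k : (k <= n)%N -> pdle (n - k) (S k).
  elim: k => [|k IH] kn; first by rewrite subn0.
  have := IH (ltnW kn); rewrite -(subnSK kn).
  by move/(pdle_syz iotaC Rfin _ (cover_ses (c k)) (@cover_proj _ (c k))).
(* The syzygy [S n] is projective, so its cover has zero kernel and all later syzygies vanish. A
   term in degree above n lies between two such zero syzygies. *)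
have tS k : (n <= k)%N -> trivial_mod (S k.+1).
  elim: k => [|k IH] nk.
    apply: cover_projective; have := pS 0%N (leq0n _); rewrite subn0.
    by move: nk; rewrite leqn0 => /eqP -> /(pdle0 iotaC Rfin).
  apply: cover_projective; move: nk; rewrite leq_eqVlt => /orP[/eqP e|/IH].
    by have := pS n (leqnn _); rewrite subnn => /(pdle0 iotaC Rfin); rewrite e.
  exact: trivial_projective.
case: m nm => // m nm y; have [_ _ pk] := cover_ses (c m.+1).
have /pk[x <-] : cover_p (c m.+1) y = 0 by exact: (tS m nm).
by rewrite (tS m.+1 _ x) ?linear0 //; exact: ltnW.
Qed.

Lemma min_inj_coresolution M : exists I : inj_coresolution M,
  minimal_inj I /\ forall n, idle n M -> forall m, (n < m)%N -> trivial_mod (I m).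
Proof.
pose S := cosyzygy M; pose c n := hul (S n).
pose d n : {linear hull_obj (c n) -> hull_obj (c n.+1)} :=
  hull_i (c n.+1) \o hull_p (c n).
have kd n : ker (d n) = range (hull_i (c n)).
  have [ii _ _] := hull_ses (c n.+1); have [_ _ pk] := hull_ses (c n).
  apply/seteqP; split => [x|_ [x _ <-]]; rewrite /ker /=.
    by move/(inj0 ii)/pk => -[y <-]; exists y.
  by rewrite (ses_comp _ (hull_ses (c n))) linear0.
have rd n : range (d n) = range (hull_i (c n.+1)).
  have [_ ps _] := hull_ses (c n).
  apply/seteqP; split => [_ [x _ <-]|_ [x _ <-]]; first by exists (hull_p (c n) x).
  by have [z <-] := ps x; exists z.
unshelve eexists.
  apply: (@InjCoresolution R M (fun n => hull_obj (c n)) (hull_i (c 0%N)) d).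
  - by move=> n; exact: fmP.
  - by move=> n; exact: hull_inj.
  - by have [ii _ _] := hull_ses (c 0%N).
  - by rewrite kd.
  - by move=> n; rewrite rd kd.
split; first by split => [|n] /=; rewrite ?rd; exact: hull_min.
move=> n pM m nm /=.
have pS k : (k <= n)%N -> idle (n - k) (S k).
  elim: k => [|k IH] kn; first by rewrite subn0.
  have := IH (ltnW kn); rewrite -(subnSK kn).
  by move/(idle_cosyz iotaC Rfin _ (hull_ses (c k)) (@hull_inj _ (c k))).
have tS k : (n <= k)%N -> trivial_mod (S k.+1).
  elim: k => [|k IH] nk.
    apply: hull_injective; have := pS 0%N (leq0n _); rewrite subn0.
    by move: nk; rewrite leqn0 => /eqP -> /(idle0 iotaC Rfin).
  apply: hull_injective; move: nk; rewrite leq_eqVlt => /orP[/eqP e|/IH].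
    by have := pS n (leqnn _); rewrite subnn => /(idle0 iotaC Rfin); rewrite e.
  exact: trivial_injective.
case: m nm => // m nm y; have [_ _ pk] := hull_ses (c m.+1).
have /pk[x <-] : hull_p (c m.+1) y = 0 by apply: (tS m.+1); exact: ltnW.
by rewrite (tS m nm x) linear0.
Qed.

(** An arbitrary finite resolution gives the Ext bound by dimension shifting; conversely the minimal
    resolution stops in time. *)
Lemma projdim_leP M n : projdim_le M n <-> pdle n M.
Proof.
split => [[P Pn]|pM]; last first.
  by have [P [_ h]] := min_proj_resolution M; exists P; exact: h.
pose F j := Fmod (pr_fg P j).
(* Here [Z] is the [j]-th syzygy of the given resolution and [m] the length that remains. *)
have tail m : forall j, (n = j + m)%N -> forall Z (p : {linear F j -> Z}),
    (forall z, exists y, p y = z) -> ker p = range (pr_d P j) -> pdle m Z.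
  elim: m => [|m IH] j nE Z p ps pk.
    apply/(pdle0 iotaC Rfin); apply: projective_retract (@pr_proj _ _ P j).
    apply/iso_retract/iso_sym; exists p; apply: lin_bij ps.
    apply: lin_inj => x px; have : ker p x by [].
    by rewrite pk => -[y _ <-]; rewrite (Pn j.+1 _ y) ?linear0 // nE addn0.
  have [X [i s]] := ker_ses Rfin ps; have [ii _ ik] := s.
  apply/(pdle_syz iotaC Rfin m s (@pr_proj _ _ P j)).
  have [|q qE] := @factor_inj _ _ _ _ i (pr_d P j : {linear F j.+1 -> F j}) ii.
    move=> w; apply/ik; have : range (pr_d P j) (pr_d P j w) by exists w.
    by rewrite -pk.
  apply: (IH j.+1 _ X q); first by rewrite nE addnS.
    move=> x; have : ker p (i x) by rewrite /ker /= (ses_comp _ s).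
    by rewrite pk => -[w _ wE]; exists w; apply: ii; rewrite qE.
  rewrite pr_exact; apply/seteqP; split => x; rewrite /ker /= -qE.
    by move=> ->; rewrite linear0.
  exact: inj0.
apply: (tail n 0%N _ M (pr_aug P)) => //; last by rewrite pr_exact0.
by move=> y; have [x _ <-] : range (pr_aug P) y; [rewrite pr_aug_surj|exists x].
Qed.

Lemma injdim_leP M n : injdim_le M n <-> idle n M.
Proof.
split => [[I In]|pM]; last first.
  by have [I [_ h]] := min_inj_coresolution M; exists I; exact: h.
pose F j := Fmod (ir_fg I j).
have tail m : forall j, (n = j + m)%N -> forall Z (i : {linear Z -> F j}),
    injective i -> range i = ker (ir_d I j) -> idle m Z.
  elim: m => [|m IH] j nE Z i ii ir.
    apply/(idle0 iotaC Rfin); apply: injective_retract (@ir_inj _ _ I j).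
    apply/iso_retract; exists i; apply: lin_bij ii _ => y.
    have [x _ <-] : range i y; last by exists x.
    by rewrite ir; apply: (In j.+1); rewrite nE addn0.
  have [X [p s]] := coker_ses ii; have [_ ps pk] := s.
  apply/(idle_cosyz iotaC Rfin m s (@ir_inj _ _ I j)).
  have [|q qE] := @factor_surj _ _ _ _ p (ir_d I j : {linear F j -> F j.+1}) ps.
    by move=> w /pk[x <-]; have : range i (i x); [exists x|rewrite ir].
  apply: (IH j.+1 _ X q); first by rewrite nE addnS.
    apply: lin_inj => x; have [y <-] := ps x; rewrite qE => dy.
    have : ker (ir_d I j) y by [].
    by rewrite -ir => -[z _ <-]; exact: ses_comp s.
  rewrite -ir_exact; apply/seteqP; split => _ [x _ <-].
    by have [y <-] := ps x; rewrite qE; exists y.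
  by rewrite -qE; exists (p x).
apply: (tail n 0%N _ M (ir_aug I)) => //; first exact: ir_aug_inj.
by rewrite ir_exact0.
Qed.

Lemma projdimP M n : projdim M n.+1 <-> pdle n.+1 M /\ ~ pdle n M.
Proof.
split => [[/projdim_leP h hm]|[h hm]].
  by split => // /projdim_leP/hm; rewrite ltnn.
split; first exact/projdim_leP.
move=> m /projdim_leP pm; rewrite ltnNge; apply/negP => mn.
exact/hm/(pdle_leq iotaC Rfin mn).
Qed.

Lemma injdimP M n : injdim M n.+1 <-> idle n.+1 M /\ ~ idle n M.
Proof.
split => [[/injdim_leP h hm]|[h hm]].
  by split => // /injdim_leP/hm; rewrite ltnn.
split; first exact/injdim_leP.
move=> m /injdim_leP pm; rewrite ltnNge; apply/negP => mn.
exact/hm/(idle_leq iotaC Rfin mn).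
Qed.

(** If the injective hull of [M] were projective, it would witness that [M] is torsionless. *)
Lemma domdim0_of_torsion M : ~ torsionless M -> domdim M 0.
Proof.
move=> nM; have [I [mI _]] := min_inj_coresolution M; exists I; split => // pI.
apply: nM; exists (Fmod (ir_fg I 0)), (ir_aug I).
by split; [split => //; exact: ir_inj|exact: ir_aug_inj].
Qed.

Lemma codomdim0_of_cotorsion M : ~ cotorsionless M -> codomdim M 0.
Proof.
move=> nM; have [P [mP _]] := min_proj_resolution M; exists P; split => // iP.
apply: nM; exists (Fmod (pr_fg P 0)), (pr_aug P).
split; first by split => //; exact: pr_proj.
by move=> y; have [x _ <-] : range (pr_aug P) y; [rewrite pr_aug_surj|exists x].
Qed.

Lemma coresolution_seq M (I : inj_coresolution M) :
  exists (C : nat -> fmod R)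
    (c : forall n, {linear C n -> Fmod (ir_fg I n)})
    (q : forall n, {linear Fmod (ir_fg I n) -> C n.+1}),
    isomorphic M (C 0%N) /\ forall n, ses (c n) (q n).
Proof.
pose F n := Fmod (ir_fg I n).
(* Each witness has a type depending on the previous ones, so they are chosen one after another. *)
pose z n := cid (im_fmod (ir_d I n : {linear F n -> F n.+1})).
pose Z n := projT1 (z n).
pose hq n := cid (projT2 (z n)); pose q n : {linear F n -> Z n} := projT1 (hq n).
pose hj n := cid (projT2 (hq n)); pose j n : {linear Z n -> F n.+1} := projT1 (hj n).
have qj n : [/\ forall z, exists x, q n x = z, injective (j n)
    & forall x, j n (q n x) = ir_d I n x] := projT2 (hj n).
pose C n := if n is m.+1 then Z m else M.
pose c n : {linear C n -> F n} :=
  match n return {linear C n -> F n} with 0 => ir_aug I | m.+1 => j m end.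
exists C, c, q.
split; first by exists idfun; exists idfun.
have qk n y : q n y = 0 <-> ker (ir_d I n) y.
  have [_ ji e] := qj n; rewrite /ker /= -e; split => [->|/(inj0 ji)//].
  exact: linear0.
case=> [|n]; split.
- exact: ir_aug_inj.
- by have [] := qj 0%N.
- by move=> y; rewrite qk -ir_exact0; split => [[x _ <-]|[x <-]]; exists x.
- by have [] := qj n.
- by have [] := qj n.+1.
- move=> y; rewrite qk -ir_exact; have [qs _ e] := qj n.
  split => [[x _ <-]|[x <-]]; first by exists (q n x); rewrite e.
  by have [w <-] := qs x; exists w; rewrite ?e.
Qed.

(** * The equivalences for global and dominant dimension e + 2 *)

Lemma higher_auslander_tfae e : gldim R e.+2 -> domdim R^o e.+2 ->
  [<-> finite_type (fun _ : lmodType R => True);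
       finite_type (fun M : lmodType R => projdim M e.+2);
       finite_type (fun M : lmodType R => injdim M e.+2);
       finite_type (fun M : lmodType R => domdim M 0);
       finite_type (fun M : lmodType R => codomdim M 0)].
Proof.
move=> [gl _] [I [_ _ pI]].
have gR M N : ext e.+2 M N := iffLR (projdim_leP M _) (gl _ (fmP M)) N.
have [C [c [q [C0 cq]]]] := @coresolution_seq (freg R) I.
have pQ n : (n < e.+2)%N -> pinj (Fmod (ir_fg I n)).
  by move=> /pI pn; split => //; exact: ir_inj.
have ft_sub (D D' : lmodType R -> Prop) :
    (forall M, D M -> D' M) -> finite_type D' -> finite_type D.
  by move=> DD' /(finite_typeP Rfin)[G GP]; apply/(finite_typeP Rfin);
    exists G => M iM /DD'; exact: GP.
have h21 : finite_type (fun M : lmodType R => projdim M e.+2) ->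
    finite_type (fun _ : lmodType R => True).
  move=> /(finite_typeP Rfin)[G GP]; apply/(finite_typeP Rfin).
  (* The propagation starts at e + 1: failing this bound means having projective dimension e + 2. *)
  have [||H HP] := @finite_type_of_pd _ _ _ iotaC Rfin e.+1.
  - exact: pdle_torsionless cq pQ C0 gR.
  - exists G => M iM nM; apply: GP => //; apply/projdimP; split => // N.
  - by exists H => M iM _; exact: HP.
have h31 : finite_type (fun M : lmodType R => injdim M e.+2) ->
    finite_type (fun _ : lmodType R => True).
  move=> /(finite_typeP Rfin)[G GP]; apply/(finite_typeP Rfin).
  have [||H HP] := @finite_type_of_id _ _ _ iotaC Rfin e.+1.
  - exact: idle_cotorsionless cq pQ C0 gR.
  - exists G => M iM nM; apply: GP => //; apply/injdimP; split => // N.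
  - by exists H => M iM _; exact: HP.
have h42 : finite_type (fun M : lmodType R => domdim M 0) ->
    finite_type (fun M : lmodType R => projdim M e.+2).
  apply: ft_sub => M /projdimP[_ h]; apply: domdim0_of_torsion.
  by move=> /(torsionless_pdle iotaC Rfin gR).
have h53 : finite_type (fun M : lmodType R => codomdim M 0) ->
    finite_type (fun M : lmodType R => injdim M e.+2).
  apply: ft_sub => M /injdimP[_ h]; apply: codomdim0_of_cotorsion.
  by move=> /(cotorsionless_idle iotaC Rfin gR).
have all_ (D : lmodType R -> Prop) : finite_type (fun _ : lmodType R => True) -> finite_type D.
  exact: (ft_sub D (fun=> True)).
(* Every link of the cycle passes through finite representation type, which implies all the other
   conditions. *)
tfae.
- exact: all_.
- by move/h21; exact: all_.
- by move/h31; exact: all_.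
- by move/h42/h21; exact: all_.
- by move/h53/h31.
Qed.

(* If S_i x is not contained in a maximal submodule N, then, S_i being simple,
   M is the direct sum of N and S_i x. *)
Lemma semisimple_finite_type :
  semisimple R^o -> finite_type (fun _ : lmodType R => True).
Proof.
move=> [n [S [simpS decS]]].
have sS i : submodule (S i) by have [] := simpS i.
have hF i := cid (sub_exists (sS i)); pose F i := projT1 (hF i).
pose hj i := cid (projT2 (hF i)); pose j i : {linear F i -> R^o} := projT1 (hj i).
have jP i : injective (j i) /\ forall y, S i y <-> exists x, j i x = y := projT2 (hj i).
exists n, F => M fM iM _; pose M' := Fmod fM.
have [nM splitM] := iM.
(* The dimensions of proper submodules of [M]; the largest one provides the maximal submodule
   [N]. *)
pose D m := `[< exists N (u : {linear N -> M'}),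
  [/\ injective u, exists x, forall y, u y <> x & kdim Rfin N = m] >].
have exD : exists m, D m.
  have [x x0] : exists x : M, x <> 0.
    by apply: contrapT => h; apply: nM => x; apply: contrapT => x0; apply: h; exists x.
  exists (kdim Rfin (fzero R)); apply/asboolP; exists (fzero R), \0%R; split => //.
    by apply: lin_inj => y _; exact: fzero_trivial.
  by exists x => y /esym.
have ubD m : D m -> (m <= kdim Rfin M')%N.
  by move=> /asboolP[N [u [ui _ <-]]]; exact: kdim_inj ui.
have [m /asboolP[N [u [ui [x xN] Nm]]] mmax] := ex_maxnP exD ubD.
(* Write 1 as a sum of elements of the [S i]: if each of them sent [x] into [N], then [x] would lie
   in [N]. *)
have [i [s [Ss sx]]] : exists i s, S i s /\ forall y, u y <> s *: x.
  have [f [[fS e1] _]] := decS 1; apply: contrapT => h.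
  have /choice[y yE] i : exists y, u y = f i *: x.
    by apply: contrapT => h'; apply: h; exists i, (f i); split => // y e; apply: h'; exists y.
  apply: (xN (\sum_i y i)); rewrite linear_sum -[RHS]scale1r [in RHS]e1.
  rewrite [RHS]scaler_suml.
  by apply: eq_bigr => k _; exact: yE.
pose g : {linear F i -> M} := scalemap x \o j i; have [ji jS] := jP i.
(* The elements of [S i] sending [x] into [N] form a submodule [T] of a simple module that misses
   [s], so [T] is zero. Hence [g] is injective and its image meets [N] trivially. *)
have gu r y : g r = u y -> r = 0 /\ y = 0.
  pose T : set R^o := [set t | S i t /\ exists y, u y = (t : R) *: x]%classic.
  have sT : submodule T.
    split; first by rewrite inE; split; [exact: submodule0|exists 0; rewrite linear0 scale0r].
    move=> a t t'; rewrite !inE => -[St [y1 e1]] [St' [y2 e2]]; split.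
      exact: submoduleP.
    by exists (a *: y1 + y2); rewrite linearP e1 e2 scalerDl scalerA.
  have [_ _ /(_ T sT)] := simpS i => -[t []//|T0|TS] e; last first.
    by have [_ [y' /sx]] : T s by rewrite TS.
  have r0 : r = 0.
    apply: (inj0 ji); suff : T (j i r) by rewrite T0.
    by split; [apply/jS; exists r|exists y].
  by split => //; apply: (inj0 ui); rewrite -e r0 linear0.
have fi : fg (F i) by exact: (fg_sub Rfin ji (fg_reg R)).
pose FN := fprod (Fmod fi) N.
have hi : injective (copairmap g u : {linear FN -> M'}).
  apply: lin_inj => -[r y] /= /eqP; rewrite addr_eq0 -linearN => /eqP /gu[-> y0].
  by apply/pair_equal_spec; split => //; rewrite -[y]opprK y0 oppr0.
have nF : ~ trivial_mod (F i).
  move=> tF; have [_ nS _] := simpS i; apply: nS; apply/seteqP; split => t.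
    by move=> /jS[r <-]; rewrite (tF r) linear0.
  by move=> ->; exact: submodule0.
(* Otherwise the sum of [N] and the image of [g] would be a proper submodule of larger dimension. *)
have hs y : exists z, (copairmap g u : {linear FN -> M'}) z = y.
  apply: contrapT => h.
  have le : (kdim Rfin FN <= kdim Rfin N)%N.
    rewrite Nm; apply: mmax; apply/asboolP; exists FN, (copairmap g u); split => //.
    by exists y => z e; apply: h; exists z.
  have ii : injective (linr (Fmod fi) N : {linear N -> FN}) by move=> y1 y2 /= [].
  apply: nF => r; have [z /= [-> //]] := kdim_inj_eq (Rfin := Rfin) ii le (r, 0).
exists i; apply: iso_sym; exists g.
have [//|tN] := splitM (F i) N (iso_sym (ex_intro _ _ (lin_bij hi hs))).
apply: lin_bij => [r r' e|y].
  have /(congr1 fst) // : (r, 0) = (r', 0) :> FN by exact/hi/(congr1 (+%R^~ (u 0)) e).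
by have [[r z] /= <-] := hs y; exists r; rewrite /= (tN z) linear0 addr0.
Qed.

End Minimal.

(** * The converse ring *)

Section Opposite.
Variables (K : fieldType) (A : falgType K).

Definition op_scalar (k : K) : A^c := k%:A : A.

Lemma op_scalar_monoid : monoid_morphism op_scalar.
Proof.
split; first exact: scale1r.
move=> a b; rewrite -[RHS]/((b%:A : A) * a%:A) mulr_algl scalerA mulrC.
by [].
Qed.

Lemma op_scalar_additive : {morph op_scalar : x y / x - y}.
Proof. by move=> a b; exact: scalerBl. Qed.

HB.instance Definition _ := GRing.isZmodMorphism.Build K A^c op_scalar op_scalar_additive.
HB.instance Definition _ := GRing.isMonoidMorphism.Build K A^c op_scalar op_scalar_monoid.

Lemma op_scalarC k (r : A^c) : op_scalar k * r = r * op_scalar k.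
Proof.
rewrite -[LHS]/((r : A) * k%:A) -[RHS]/(k%:A * (r : A)).
by rewrite mulr_algl mulr_algr.
Qed.

Lemma op_finite : exists n (b : 'I_n -> A^c), forall r, exists c : 'I_n -> K,
  r = \sum_i op_scalar (c i) * b i.
Proof.
exists (\dim {:A}), (fun i => (vbasis {:A})`_i) => r.
exists (fun i => coord (vbasis {:A}) i r); rewrite {1}(coord_vbasis (memvf (r : A))).
by apply: eq_bigr => i _; rewrite op_scalarC; apply/esym; exact: mulr_algl.
Qed.

End Opposite.

Theorem theorem3p11 (K : fieldType) (A : falgType K) (d : nat) :
  connected_alg A -> higher_auslander A -> gldim A^c%type d ->
  [<-> finite_type (fun _ : lmodType A^c => True);
       finite_type (fun M : lmodType A^c => projdim M d);
       finite_type (fun M : lmodType A^c => injdim M d);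
       finite_type (fun M : lmodType A^c => domdim M 0);
       finite_type (fun M : lmodType A^c => codomdim M 0)].
Proof.
move=> _ hA gd; case: hA => [[d' [d2 gd' dd]]|ss].
  (* Both numbers are the least upper bound of the projective dimensions. *)
  have dE : d' = d.
    by apply/eqP; rewrite eqn_leq; case: gd gd' => g m [g' m']; rewrite m' ?m.
  case: d' d2 gd' dd dE => [|[|e]] // _ ge de <-.
  exact: (higher_auslander_tfae (@op_scalarC K A) (op_finite A)).
(* In the semisimple case all five conditions hold outright. *)
have [n [F FP]] := semisimple_finite_type (op_finite A) ss.
by tfae => _; exists n, F => M fM iM _; exact: FP.
Qed.
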